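(* Let $d\ge 1$ be an integer and $\vec{\mu}=(\mu_0,\dots,\mu_{d-1})$ a probability distribution with $\max_i\mu_i\in[1/d,\,3-2\sqrt2]$ (so necessarily $d\ge 6$). Let $\mathcal{O}_{\vec{\mu}}$ be the generalized platypus channel associated with $\vec{\mu}$. Then there exists $\lambda\in[0,1]$ such that $$Q(\mathcal{O}_{\vec{\mu}}\otimes\mathcal{E}_{\lambda,d})>Q(\mathcal{O}_{\vec{\mu}})+Q(\mathcal{E}_{\lambda,d}).$$
   Context: Logarithms are base 2. Generalized platypus channel: let $A$ and $B$ be $(d+1)$-dimensional Hilbert spaces with computational bases $\{|i\rangle\}_{i=0}^{d}$ and $E$ a $d$-dimensional Hilbert space with basis $\{|j\rangle\}_{j=0}^{d-1}$. Define the isometry $V:A\to B\otimes E$ by $V|0\rangle=\sum_{j=0}^{d-1}\sqrt{\mu_j}\,|j\rangle_B\otimes|j\rangle_E$ and $V|i\rangle=|d\rangle_B\otimes|i-1\rangle_E$ for $i=1,\dots,d$; $\mathcal{O}_{\vec{\mu}}(\rho)=\mathrm{Tr}_E(V\rho V^\dagger)$. Qudit erasure channel: $\mathcal{E}_{\lambda,d}$ maps states on a $d$-dimensional space $A'$ to states on the $(d+1)$-dimensional space $A'\oplus\mathrm{span}\{|e\rangle\}$ by $\mathcal{E}_{\lambda,d}(\rho)=(1-\lambda)\rho+\lambda|e\rangle\langle e|$, with $|e\rangle$ orthogonal to $A'$. For a channel $\mathcal{N}$ with complementary channel $\mathcal{N}^c$, $Q^{(1)}(\mathcal{N})=\max_\rho[S(\mathcal{N}(\rho))-S(\mathcal{N}^c(\rho))]$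 ($S$ = von Neumann entropy) and the quantum capacity is $Q(\mathcal{N})=\lim_{n\to\infty}\frac1nQ^{(1)}(\mathcal{N}^{\otimes n})$. *)

(* Defs.v *)
From HB Require Import structures.
From mathcomp Require Import all_boot all_order all_algebra.
From mathcomp Require Import all_classical all_reals all_analysis.
From mathcomp.real_closed Require Import complex.
Set Implicit Arguments. Unset Strict Implicit. Unset Printing Implicit Defensive.
Import Order.TTheory GRing.Theory Num.Theory numFieldNormedType.Exports.
Local Open Scope ring_scope.
Local Open Scope complex_scope.

Section QInfo.
Variable R : realType.
Local Notation C := R[i].

(* Operators on a finite-dimensional Hilbert space with orthonormal basis
   indexed by a finite type A: matrices A x A. *)
Definition op (A : finType) := A -> A -> C.

Definition lmap (A B : finType) := B -> A -> C.

Definition mx_of (A : finType) (rho : op A) : 'M[C]_#|{: A}| :=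
  \matrix_(i, j) rho (enum_val i) (enum_val j).

Definition trace (A : finType) (rho : op A) : C := \sum_a rho a a.

(* density operators: positive semidefinite (hence Hermitian) of trace one *)
Definition psd (A : finType) (rho : op A) : Prop :=
  forall v : A -> C, 0 <= \sum_a \sum_b (v a)^* * rho a b * v b.

Definition density (A : finType) (rho : op A) : Prop :=
  psd rho /\ trace rho = 1.

(* base-2 logarithm; eta x = x log2 x (with eta 0 = 0 since ln 0 = 0) *)
Definition log2 (x : R) : R := ln x / ln 2.
Definition eta (x : R) : R := x * log2 x.

(* von Neumann entropy: - sum over eigenvalues (with multiplicity, i.e. the
   roots of the characteristic polynomial) of lambda log2 lambda. *)
Definition vN_entropy (A : finType) (rho : op A) : R :=
  xget 0 [set r : R | exists s : seq C,
      char_poly (mx_of rho) = \prod_(x <- s) ('X - x%:P) /\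
      r = - \sum_(x <- s) eta (complex.Re x)].

Definition conj_map (A B : finType) (V : lmap A B) (rho : op A) : op B :=
  fun b b' => \sum_a \sum_a' V b a * rho a a' * (V b' a')^*.

Definition ptrE (B E : finType) (X : op (B * E)%type) : op B :=
  fun b b' => \sum_e X (b, e) (b', e).
Definition ptrB (B E : finType) (X : op (B * E)%type) : op E :=
  fun e e' => \sum_b X (b, e) (b, e').

(* A channel given through a Stinespring isometry V : A -> B (x) E. *)
Record chan := Chan {
  chA : finType; chB : finType; chE : finType;
  chV : lmap chA (chB * chE)%type }.
Arguments chV : clear implicits.

Definition apply_chan (N : chan) (rho : op (chA N)) : op (chB N) :=
  @ptrE (chB N) (chE N) (@conj_map (chA N) _ (chV N) rho).
Definition apply_comp (N : chan) (rho : op (chA N)) : op (chE N) :=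
  @ptrB (chB N) (chE N) (@conj_map (chA N) _ (chV N) rho).

Arguments apply_chan : clear implicits.
Arguments apply_comp : clear implicits.

Definition Q1 (N : chan) : R :=
  sup [set x : R | exists rho : op (chA N), density rho /\
        x = vN_entropy (apply_chan N rho) - vN_entropy (apply_comp N rho)].

Definition chan_tens (N M : chan) : chan :=
  @Chan (chA N * chA M)%type (chB N * chB M)%type (chE N * chE M)%type
    (fun be a => chV N (be.1.1, be.2.1) a.1 * chV M (be.1.2, be.2.2) a.2).

Definition chan_pow (N : chan) (n : nat) : chan :=
  @Chan {ffun 'I_n -> chA N} {ffun 'I_n -> chB N} {ffun 'I_n -> chE N}
    (fun be a => \prod_(i < n) chV N (be.1 i, be.2 i) (a i)).

Definition Qcap (N : chan) : R :=
  limn (fun n : nat => Q1 (chan_pow N n.+1) / n.+1%:R).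

Definition platypus (d : nat) (mu : 'I_d -> R) : chan :=
  @Chan 'I_d.+1 'I_d.+1 'I_d
    (fun be a =>
       if a == 0 :> nat then
         (if (be.1 == be.2 :> nat) then (Num.sqrt (mu be.2))%:C else 0)
       else if (be.1 == d :> nat) && (be.2.+1 == a :> nat) then 1 else 0).

(* qudit erasure channel E_{lam,d} : A' = C^d  ->  A' (+) |e>, where the
   erasure flag |e> is the basis vector of index d; Stinespring dilation
   V|psi> = sqrt(1-lam) |psi>_B |e>_E + sqrt(lam) |e>_B |psi>_E. *)
Definition erasure (lam : R) (d : nat) : chan :=
  @Chan 'I_d 'I_d.+1 'I_d.+1
    (fun be a =>
       if (be.1 == a :> nat) && (be.2 == d :> nat) then (Num.sqrt (1 - lam))%:C
       else if (be.1 == d :> nat) && (be.2 == a :> nat) then (Num.sqrt lam)%:C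
       else 0).

End QInfo.

(* Main.v *)
(* Take lam = 1/2, for which the erasure channel is symmetric between receiver and environment, so
   that its capacity vanishes.

   Upper bound for the platypus channel.  If the partial transpose of the Choi matrix is
   sum_k eps_k |h_k><h_k| with |eps_k| <= 1, then the state N(psi) of reference and output is
   dominated by 1 (x) sigma, where sigma comes from sum_k |h_k><h_k|; this domination bounds the
   coherent information by log tr sigma.  The decomposition is multiplicative under tensor powers,
   and for the platypus channel it gives Q <= log (1 + sqrt (max mu)) <= 1/2.

   Lower bound for the joint channel.  Mix with equal weights |0>|j0> and the entangled vector
   sum_j sqrt (mu_j) |j+1>|j>.  The coherent information would be exactly 1/2 if the environment
   states of the two branches were orthogonal; they overlap as soon as mu_j0 > 0, which strictly
   decreases the entropy of the environment. *)
From Pilot Require Import Defs.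
From HB Require Import structures.
From mathcomp Require Import all_boot all_order all_algebra.
From mathcomp Require Import all_classical all_reals all_analysis.
From mathcomp.real_closed Require Import complex.
From mathcomp Require Import spectral ring lra.
Set Implicit Arguments.
Unset Strict Implicit.
Unset Printing Implicit Defensive.
Import Order.TTheory GRing.Theory Num.Theory numFieldNormedType.Exports.
Import Pilot.Defs.
Local Open Scope complex_scope.
Local Open Scope ring_scope.

(** * Von Neumann entropy and Gram matrices *)

(** The threshold is [3 - 2 * sqrt 2 = (sqrt 2 - 1) ^ 2], the value of [max mu] at which
    [1 + sqrt (max mu)] reaches [sqrt 2]. At this endpoint the upper bound is exactly 1/2, so the
    strict inequality has to come from the joint input. The term [sqrt (max mu)] is a balance: the
    indefinite block of the partial transpose costs [s] on input 0 and at most [max mu / s] on the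
    other inputs. No logarithm of an operator occurs. States are Gram matrices, whose two orders of
    multiplication share their nonzero spectrum, and entropy inequalities become Shannon sums in
    well chosen eigenbases. Domination survives negative [eps_k] because the partial transpose only
    exchanges two reference indices, and the arithmetic-geometric mean inequality symmetrises them
    again. A capacity is a limit of suprema, so boundedness, nonemptiness and convergence come
    before any comparison. *)

Lemma det_XsubM_comm (K : fieldType) m n (A : 'M[{poly K}]_(m, n)) (B : 'M[{poly K}]_(n, m)) (x :
    {poly K}) :
  x ^+ n * \det (x%:M - A *m B) = x ^+ m * \det (x%:M - B *m A).
Proof.
(* Sylvester's identity: the determinant of [M] is computed by clearing [B] once from the right,
   leaving [x - A B], and once from the left, leaving [x - B A]. *)
pose M : 'M[{poly K}]_(m + n) := block_mx x%:M A B 1%:M.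
have h1 : \det M = \det (x%:M - A *m B).
  have d1 : \det (block_mx 1%:M 0 (- B) 1%:M : 'M[{poly K}]_(m + n)) = 1.
    by rewrite det_lblock !det_scalar !expr1n mulr1.
  rewrite -[LHS]mulr1 -[X in _ * X]d1 -det_mulmx mulmx_block !mulmx1 !mulmx0 !mul1mx mulmxN subrr
      !add0r.
  by rewrite det_ublock det_scalar expr1n mulr1.
have : \det (block_mx 1%:M 0 (- B) x%:M : 'M[{poly K}]_(m + n)) * \det M =
    x ^+ m * \det (x%:M - B *m A).
  rewrite -det_mulmx mulmx_block !mul1mx !mul0mx !mulmx1 !addr0.
  rewrite !mulNmx mul_mx_scalar mul_scalar_mx addNr addrC det_ublock det_scalar.
  by rewrite addrC [_ + x%:M]addrC.
by rewrite det_lblock det1 mul1r det_scalar h1.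
Qed.

Lemma char_poly_mul_comm (K : fieldType) m n (A : 'M[K]_(m, n)) (B : 'M[K]_(n, m)) :
  'X^n * char_poly (A *m B) = 'X^m * char_poly (B *m A).
Proof. by rewrite /char_poly /char_poly_mx !map_mxM /= det_XsubM_comm. Qed.

Lemma char_poly_trmx (K : comNzRingType) n (A : 'M[K]_n) : char_poly A^T = char_poly A.
Proof. by rewrite /char_poly -det_tr /char_poly_mx raddfB /= tr_scalar_mx map_trmx trmxK. Qed.

Section Entropy.
Variable R : realType.
Local Notation C := R[i].

(** Linear factors are unique up to order, so the value chosen by [xget] does not depend on the
    factorisation. *)
Lemma vN_entropyE (A : finType) (rho : op R A) (s : seq C) :
  char_poly (mx_of rho) = \prod_(x <- s) ('X - x%:P) ->
  vN_entropy rho = - \sum_(x <- s) eta (complex.Re x).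
Proof.
move=> hs; rewrite /vN_entropy.
set P := (X in xget _ X).
have hP : P (- \sum_(x <- s) eta (complex.Re x)) by exists s.
have [s' [hs' ->]] : P (xget 0 P) by apply: xgetPex; exists (- \sum_(x <- s) eta (complex.Re x)).
congr (- _); apply: perm_big => /=.
by apply: prod_XsubC_eq; rewrite -hs' hs.
Qed.

Lemma vN_entropy_ext (A : finType) (rho sigma : op R A) :
  (forall a b, rho a b = sigma a b) -> vN_entropy rho = vN_entropy sigma.
Proof. by move=> h; congr vN_entropy; apply/funext => a; apply/funext => b. Qed.

(** The reduced state on [A] of the vector with amplitudes [T a i]; [I] is the purifying system. *)
Definition gram (I A : finType) (T : A -> I -> C) : op R A :=
  fun a b => \sum_i T a i * (T b i)^*.

Lemma eta0 : eta (0 : R) = 0.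
Proof. by rewrite /eta mul0r. Qed.

Lemma char_poly_split n (M : 'M[C]_n) :
  exists s : seq C, char_poly M = \prod_(x <- s) ('X - x%:P).
Proof.
have [s hs] := closed_field_poly_normal (char_poly M).
by exists s; rewrite {1}hs (monicP (char_poly_monic M)) scale1r.
Qed.

(** Both reduced states of a pure vector have the same entropy: the characteristic polynomials agree
    up to powers of the variable, that is up to roots 0, and [eta 0 = 0]. *)
Lemma vN_entropy_gramT (I A : finType) (T : A -> I -> C) :
  vN_entropy (gram T) = vN_entropy (gram (fun i a => T a i)).
Proof.
pose M : 'M[C]_(#|{: A}|, #|{: I}|) := \matrix_(i, j) T (enum_val i) (enum_val j).
have h1 : mx_of (gram T) = M *m (map_mx Num.conj M)^T.
  apply/matrixP => i j; rewrite !mxE /gram (reindex_onto enum_val enum_rank) /=; last first.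
    by move=> x _; rewrite enum_rankK.
  by apply: eq_big => [k|k _]; rewrite ?enum_valK ?eqxx// !mxE.
have h2 : mx_of (gram (fun i a => T a i)) = ((map_mx Num.conj M)^T *m M)^T.
  apply/matrixP => i j; rewrite !mxE /gram (reindex_onto enum_val enum_rank) /=; last first.
    by move=> x _; rewrite enum_rankK.
  by apply: eq_big => [k|k _]; rewrite ?enum_valK ?eqxx// !mxE mulrC.
have [s1 hs1] := char_poly_split (mx_of (gram T)).
have [s2 hs2] := char_poly_split (mx_of (gram (fun i a => T a i))).
rewrite (vN_entropyE hs1) (vN_entropyE hs2).
have := char_poly_mul_comm M (map_mx Num.conj M)^T.
rewrite -h1 hs1 -[in RHS]char_poly_trmx -h2 hs2 => e.
have hX k : 'X^k = \prod_(x <- nseq k (0 : C)) ('X - x%:P).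
  by rewrite big_nseq subr0 iter_mulr_1.
move: e; rewrite !hX -!big_cat /= => /prod_XsubC_eq e.
have z k : \sum_(x <- nseq k (0 : C)) eta (complex.Re x) = 0.
  by rewrite big_nseq /= eta0 iter_addr_0 mul0rn.
have h t k : \sum_(x <- t) eta (complex.Re x) = \sum_(x <- nseq k (0 : C) ++ t) eta (complex.Re x).
  by rewrite big_cat /= z add0r.
by rewrite (h s1 #|{: I}|) (h s2 #|{: A}|) (perm_big _ e).
Qed.
End Entropy.

(** * Spectral decomposition of positive semidefinite operators *)

Section Spectral.
Variable R : realType.
Local Notation C := R[i].

Lemma sum_deltar (K : pzSemiRingType) (A : finType) (F : A -> K) a :
  \sum_x F x * (x == a)%:R = F a.
Proof.
rewrite (bigD1 a) //= eqxx mulr1 big1 ?addr0 // => x /negbTE ->.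
by rewrite mulr0.
Qed.

Lemma sum_deltal (K : pzSemiRingType) (A : finType) (F : A -> K) a :
  \sum_x (x == a)%:R * F x = F a.
Proof.
rewrite (bigD1 a) //= eqxx mul1r big1 ?addr0 // => x /negbTE ->.
by rewrite mul0r.
Qed.

Definition sqn (z : C) : R := complex.Re (z * z^*).

Lemma sqnE z : (sqn z)%:C = z * z^*.
Proof.
have : 0 <= z * z^* by rewrite mul_conjC_ge0.
by rewrite /sqn => /ger0_real /RRe_real.
Qed.

Lemma sqn_ge0 z : 0 <= sqn z.
Proof. by rewrite -ler0c sqnE mul_conjC_ge0. Qed.

Lemma conjRC (x : R) : (x%:C)^* = x%:C.
Proof. exact: conjc_real. Qed.

Lemma vN_entropy_diag (A : finType) (rho : op R A) (p : A -> R) :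
  (forall a b, rho a b = (p a)%:C * (a == b)%:R) ->
  vN_entropy rho = - \sum_a eta (p a).
Proof.
move=> h.
have ht : is_trig_mx (mx_of rho).
  apply/is_trig_mxP => i j ij; rewrite mxE h (inj_eq enum_val_inj).
  by rewrite (_ : (i == j) = false) ?mulr0 // -val_eqE /= ltn_eqF.
pose s := [seq (p (enum_val i))%:C | i <- enum 'I_#|{: A}|].
rewrite (@vN_entropyE _ _ _ s).
  rewrite big_map big_enum /= (reindex_onto enum_rank enum_val) /=; last first.
    by move=> i _; rewrite enum_valK.
  congr (- _); apply: eq_big => [a|a _]; first by rewrite enum_rankK eqxx.
  by rewrite enum_rankK.
rewrite char_poly_trig // big_map big_enum /=.
by apply: eq_bigr => i _; rewrite mxE h eqxx mulr1.
Qed.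

(** Orthogonal columns make the transposed Gram matrix diagonal, so the entropy is read off their
    squared norms. *)
Lemma vN_entropy_gram_diag (I A : finType) (T : A -> I -> C) (p : I -> R) :
  (forall i j, \sum_a T a i * (T a j)^* = (p i)%:C * (i == j)%:R) ->
  vN_entropy (gram T) = - \sum_i eta (p i).
Proof. by move=> h; rewrite vN_entropy_gramT; apply: vN_entropy_diag. Qed.

Lemma psd_diag_ge0 (A : finType) (rho : op R A) a : psd rho -> 0 <= rho a a.
Proof.
move=> /(_ (fun x => (x == a)%:R)) => h.
rewrite (_ : rho a a = \sum_x \sum_y ((x == a)%:R)^* * rho x y * (y == a)%:R) //.
under eq_bigr => x _ do rewrite sum_deltar conjC_nat.
by rewrite sum_deltal.
Qed.

(** In [R[i]] a nonnegative number is real; polarising the quadratic form at [c = 1] and [c = 'i]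
    then gives hermiticity. *)
Lemma psd_hermitian (A : finType) (rho : op R A) a b : psd rho -> rho a b = (rho b a)^*.
Proof.
move=> h.
have E (c : C) : 0 <= rho a a + c * rho a b + c^* * rho b a + c^* * c * rho b b.
  have := h (fun x => (x == a)%:R + c * (x == b)%:R).
  congr (_ <= _).
  under eq_bigr => x _.
    under eq_bigr => y _ do rewrite mulrDr [_ * (c * _)]mulrA.
    rewrite big_split /= !sum_deltar rmorphD rmorphM /= !conjC_nat.
    rewrite (_ : _ + _ = (x == a)%:R * (rho x a + rho x b * c) +
                         (x == b)%:R * (c^* * (rho x a + rho x b * c))); last by ring.
    over.
  by rewrite big_split /= !sum_deltal; ring.
have ra := psd_diag_ge0 a h; have rb := psd_diag_ge0 b h.
have rr (c : C) : c * rho a b + c^* * rho b a \is Num.real.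
  have -> : c * rho a b + c^* * rho b a = (rho a a + c * rho a b + c^* * rho b a +
      c^* * c * rho b b) - (rho a a + c^* * c * rho b b) by ring.
  have cc : 0 <= c^* * c by rewrite mulrC mul_conjC_ge0.
  by rewrite rpredB // ger0_real // addr_ge0 // mulr_ge0.
have /CrealP := rr 1; have /CrealP := rr 'i%C.
have ci : ('i%C : C)^* = - 'i%C by rewrite /= /conjc /= ; congr Complex; rewrite ?oppr0.
rewrite !rmorphD !rmorphM /= !conjCK ci conjC1 !mul1r => ei e1.
have i0 : 'i%C != 0 :> C by rewrite eq_complex /= oner_eq0 andbF.
have {}ei : (rho b a)^* - (rho a b)^* = rho a b - rho b a.
  apply: (mulfI i0); rewrite !mulrBr; move: ei; rewrite !mulNr => <-.
  by rewrite addrC.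
apply: (@mulfI _ 2%:R); first by rewrite pnatr_eq0.
transitivity ((rho a b + rho b a) + (rho a b - rho b a)); first by ring.
by rewrite -ei -e1; ring.
Qed.

(** Eigenvectors are indexed by [A] itself; orthonormality and completeness are both returned, since
    changes of basis use both. *)
Lemma psd_spectral (A : finType) (rho : op R A) : psd rho ->
  exists (p : A -> R) (phi : A -> A -> C),
  [/\ forall k, 0 <= p k,
      forall k l, \sum_a phi a k * (phi a l)^* = (k == l)%:R,
      forall a b, \sum_k phi a k * (phi b k)^* = (a == b)%:R &
      forall a b, rho a b = \sum_k (p k)%:C * (phi a k * (phi b k)^*)].
Proof.
move=> hr; pose M := mx_of rho.
have hM : M = map_mx Num.conj M^T.
  by apply/matrixP => i j; rewrite !mxE; apply: psd_hermitian.
have nM : M \is normalmx by apply/normalmxP; rewrite -hM.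
have /orthomx_spectralP := nM.
rewrite invmx_unitary ?spectral_unitarymx //.
set P := spectralmx M; set D := spectral_diag M => eM.
have uP : P \is unitarymx by exact: spectral_unitarymx.
have PP : P *m map_mx Num.conj P^T = 1%:M by apply/unitarymxP.
have PP' : map_mx Num.conj P^T *m P = 1%:M by exact: mulmx1C.
pose phi (a k : A) : C := (P (enum_rank k) (enum_rank a))^*.
have sumA (F : 'I_#|{: A}| -> C) : \sum_i F i = \sum_a F (enum_rank a).
  rewrite (reindex_onto enum_rank enum_val) /=; last by move=> x _; rewrite enum_valK.
  by apply: eq_bigl => a; rewrite enum_rankK eqxx.
have o1 k l : \sum_a phi a k * (phi a l)^* = (k == l)%:R.
  have := congr1 (fun X : 'M[C]_#|{: A}| => X (enum_rank l) (enum_rank k)) PP.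
  rewrite !mxE sumA (inj_eq enum_rank_inj) eq_sym => <-.
  by apply: eq_bigr => a _; rewrite !mxE /phi conjCK mulrC.
have o2 a b : \sum_k phi a k * (phi b k)^* = (a == b)%:R.
  have := congr1 (fun X : 'M[C]_#|{: A}| => X (enum_rank a) (enum_rank b)) PP'.
  rewrite !mxE sumA (inj_eq enum_rank_inj) => <-.
  by apply: eq_bigr => k _; rewrite !mxE /phi conjCK.
pose dd k := D 0 (enum_rank k).
have hrho a b : rho a b = \sum_k dd k * (phi a k * (phi b k)^*).
  have := congr1 (fun X : 'M[C]_#|{: A}| => X (enum_rank a) (enum_rank b)) eM.
  rewrite !mxE !enum_rankK sumA => ->; apply: eq_bigr => k _.
  rewrite mul_mx_diag !mxE /phi conjCK /dd; ring.
clearbody dd phi.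
(* The eigenvalue is the value of the quadratic form at its eigenvector. *)
have dd0 k : 0 <= dd k.
  have := hr (fun a => phi a k); congr (_ <= _).
  transitivity (\sum_l dd l * ((\sum_a phi a l * (phi a k)^*) * (\sum_a phi a l * (phi a k)^*)^*)).
    under eq_bigr => a _. 
      under eq_bigr => b _ do rewrite hrho mulr_sumr mulr_suml.
      rewrite exchange_big /=; over.
    rewrite exchange_big /=; apply: eq_bigr => l _.
    rewrite raddf_sum /= mulr_suml mulr_sumr; apply: eq_bigr => a _.
    rewrite mulr_sumr mulr_sumr; apply: eq_bigr => b _.
    rewrite rmorphM /= conjCK; ring.
  rewrite (bigD1 k) //= o1 eqxx conjC1 !mulr1 big1 ?addr0 // => l lk.
  by rewrite o1 (negbTE lk) mul0r mulr0.
exists (fun k => complex.Re (dd k)), phi; split => //.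
- by move=> k; have := dd0 k; rewrite lecE => /andP[].
- by move=> a b; rewrite hrho; apply: eq_bigr => k _; rewrite RRe_real ?ger0_real.
Qed.
End Spectral.

(** * Shannon entropy inequalities *)

Section RealEntropy.
Variable R : realType.

Lemma ln2_gt0 : 0 < ln 2 :> R.
Proof. by rewrite ln_gt0 // ltr1n. Qed.

Lemma sum_eta (I : finType) (p : I -> R) :
  \sum_i eta (p i) = (\sum_i p i * ln (p i)) / ln 2.
Proof. by rewrite mulr_suml; apply: eq_bigr => i _; rewrite /eta /log2 mulrA. Qed.

Lemma mul_ln_div_le (p q : R) : 0 < p -> 0 < q -> p * (ln q - ln p) <= q - p.
Proof.
move=> p0 q0; rewrite -ln_div ?posrE //.
have h : -1 < q / p - 1 by rewrite ltrBDr addNr divr_gt0.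
have := le_ln1Dx h; rewrite addrC subrK => /(ler_wpM2l (ltW p0)).
by rewrite mulrBr mulr1 mulrCA divff ?mulr1 // gt_eqF.
Qed.

(** The equality case, from the strict inequality [1 + x < expR x] for nonzero [x]; it is the source
    of strictness in [vN_entropy_diag_le]. *)
Lemma mul_ln_div_eq (p q : R) : 0 < p -> 0 < q -> p * (ln q - ln p) = q - p -> p = q.
Proof.
move=> p0 q0; rewrite -ln_div ?posrE // => e.
have qp : 0 < q / p by rewrite divr_gt0.
have [l0|ln0] := eqVneq (ln (q / p)) 0.
  by move: e; rewrite l0 mulr0 => /esym/subr0_eq.
have := expR_gt1Dx ln0; rewrite lnK ?posrE // => lt.
have : p * (1 + ln (q / p)) < p * (q / p) by rewrite ltr_pM2l.
by rewrite mulrDr mulr1 e [X in _ < X]mulrCA divff ?gt_eqF // mulr1 addrC subrK ltxx.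
Qed.

(** The classical core of the coherent information bound, with [q] as an intermediary: [ln (p / (r
    c)) = ln (p / q) + ln (q / (r c))]. Under [ln x <= x - 1], the first part averages to at most 0
    because [\sum_j w i j / q j <= 1], the second because [\sum_j q j <= c]. *)
Lemma sum_shannon_le (I J : finType) (w : I -> J -> R) (p : I -> R) (q r : J -> R) (c : R) :
  (forall i j, 0 <= w i j) -> (forall j, 0 <= q j) ->
  (forall i, \sum_j w i j = p i) -> (forall j, \sum_i w i j = r j) ->
  (forall i, \sum_j w i j / q j <= 1) -> (forall i j, q j = 0 -> w i j = 0) ->
  \sum_j q j <= c -> 0 < c -> \sum_i p i = 1 ->
  \sum_i p i * ln (p i) - \sum_j r j * ln (r j) <= ln c.
Proof.
move=> w0 q0 hp hr hq hw hc c0 p1.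
have p0 i : 0 <= p i by rewrite -hp sumr_ge0.
have r0 j : 0 <= r j by rewrite -hr sumr_ge0.
have wp i j : w i j <= p i by rewrite -hp (bigD1 j) //= lerDl sumr_ge0.
have wr i j : w i j <= r j by rewrite -hr (bigD1 i) //= lerDl sumr_ge0.
have -> : ln c = \sum_i \sum_j w i j * ln c.
  under eq_bigr do rewrite -mulr_suml hp.
  by rewrite -mulr_suml p1 mul1r.
have -> : \sum_i p i * ln (p i) = \sum_i \sum_j w i j * ln (p i).
  by apply: eq_bigr => i _; rewrite -mulr_suml hp.
have -> : \sum_j r j * ln (r j) = \sum_i \sum_j w i j * ln (r j).
  by rewrite exchange_big; apply: eq_bigr => j _; rewrite -mulr_suml hr.
rewrite -subr_ge0 -!sumrB.
have h : \sum_i \sum_j ((w i j - w i j / q j * p i) + (w i j - w i j / r j * (q j / c))) <=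
   \sum_i (\sum_j w i j * ln c - (\sum_j w i j * ln (p i) - \sum_j w i j * ln (r j))).
  apply: ler_sum => i _; rewrite -!sumrB; apply: ler_sum => j _.
  (* Where [w i j] vanishes both sides are 0; elsewhere [p i], [q j] and [r j] are all positive. *)
  have [->|wn] := eqVneq (w i j) 0; first by rewrite !mul0r !subrr addr0.
  have wpos : 0 < w i j by rewrite lt_def wn w0.
  have qpos : 0 < q j by rewrite lt_def q0 andbT; apply: contraNneq wn => /hw ->.
  have ppos : 0 < p i by exact: lt_le_trans (wp i j).
  have rpos : 0 < r j by exact: lt_le_trans (wr i j).
  have h1 := mul_ln_div_le qpos ppos.
  have h2 := mul_ln_div_le (mulr_gt0 rpos c0) qpos.
  rewrite lnM ?posrE // in h2.
  have {}h1 : w i j * (ln (p i) - ln (q j)) <= w i j / q j * p i - w i j.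
    have -> : w i j * (ln (p i) - ln (q j)) = w i j / q j * (q j * (ln (p i) - ln (q j))).
      by rewrite [RHS]mulrA divfK // gt_eqF.
    have -> : w i j / q j * p i - w i j = w i j / q j * (p i - q j).
      by rewrite mulrBr divfK // gt_eqF.
    by apply: ler_wpM2l => //; rewrite divr_ge0 // ltW.
  have {}h2 : w i j * (ln (q j) - (ln (r j) + ln c)) <= w i j / r j * (q j / c) - w i j.
    have rc : r j * c != 0 by rewrite mulf_neq0 ?gt_eqF.
    have -> : w i j * (ln (q j) - (ln (r j) + ln c)) =
        w i j / (r j * c) * (r j * c * (ln (q j) - (ln (r j) + ln c))).
      by rewrite [RHS]mulrA divfK.
    have -> : w i j / r j * (q j / c) - w i j = w i j / (r j * c) * (q j - r j * c).
      by rewrite mulrBr divfK // invfM; ring.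
    by apply: ler_wpM2l => //; rewrite divr_ge0 // mulr_ge0 // ltW.
  by lra.
apply: le_trans h.
have e1 : \sum_i \sum_j (w i j - w i j / q j * p i) >= 0.
  apply: sumr_ge0 => i _; rewrite sumrB hp -mulr_suml subr_ge0.
  by rewrite -[leRHS]mul1r ler_wpM2r.
have e2 : \sum_i \sum_j (w i j - w i j / r j * (q j / c)) >= 0.
  rewrite exchange_big /=.
  under eq_bigr do rewrite sumrB hr -!mulr_suml hr.
  rewrite sumrB subr_ge0 -[X in _ <= X](_ : 1 = _).
    apply: (@le_trans _ _ (\sum_j q j / c)).
      apply: ler_sum => j _; have [->|rn] := eqVneq (r j) 0.
        by rewrite !mul0r divr_ge0 // ltW.
      by rewrite divff // mul1r.
    by rewrite -mulr_suml ler_pdivrMr // mul1r.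
  by rewrite -p1; under eq_bigr do rewrite -hp; under [RHS]eq_bigr do rewrite -hr;
      rewrite exchange_big.
have -> : \sum_i \sum_j ((w i j - w i j / q j * p i) + (w i j - w i j / r j * (q j / c))) =
  \sum_i \sum_j (w i j - w i j / q j * p i) + \sum_i \sum_j (w i j - w i j / r j * (q j / c)).
  by rewrite -big_split; apply: eq_bigr => i _; rewrite big_split.
exact: addr_ge0.
Qed.

(** The entropy gap is the sum of the [g i j]. Their linear parts cancel in total by double
    stochasticity, but make each term nonnegative, so that equality can be read off term by term. *)
Lemma shannon_doubly_stochastic (I J : finType) (u : I -> J -> R) (p : I -> R) (r : J -> R) :
  (forall i j, 0 <= u i j) -> (forall i, 0 <= p i) ->
  (forall i, \sum_j u i j = 1) -> (forall j, \sum_i u i j = 1) ->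
  (forall j, \sum_i p i * u i j = r j) ->
  \sum_j r j * ln (r j) <= \sum_i p i * ln (p i) /\
  (\sum_j r j * ln (r j) = \sum_i p i * ln (p i) -> forall i j, u i j = 0 \/ p i = r j).
Proof.
move=> u0 p0 hI hJ hr.
have r0 j : 0 <= r j by rewrite -hr sumr_ge0 // => i _; rewrite mulr_ge0.
pose g i j := u i j * (r j - p i) - u i j * p i * (ln (r j) - ln (p i)).
have rpos i j : 0 < u i j -> 0 < p i -> 0 < r j.
  move=> ui pi; rewrite -hr (bigD1 i) //= ltr_pwDl ?mulr_gt0 //.
  by apply: sumr_ge0 => k _; rewrite mulr_ge0.
have g0 i j : 0 <= g i j.
  rewrite /g; have [->|un] := eqVneq (u i j) 0; first by rewrite !mul0r subrr.
  have [->|pn] := eqVneq (p i) 0; first by rewrite mulr0 mul0r !subr0 mulr_ge0.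
  have up : 0 < u i j by rewrite lt_def un u0.
  have pp : 0 < p i by rewrite lt_def pn p0.
  rewrite -mulrA -mulrBr mulr_ge0 // subr_ge0 mul_ln_div_le //.
  exact: rpos up pp.
have sg : \sum_i \sum_j g i j = \sum_i p i * ln (p i) - \sum_j r j * ln (r j).
  have -> : \sum_i p i * ln (p i) = \sum_i \sum_j u i j * p i * ln (p i).
    by apply: eq_bigr => i _; rewrite -!mulr_suml hI mul1r.
  have -> : \sum_j r j * ln (r j) = \sum_i \sum_j u i j * p i * ln (r j).
    rewrite exchange_big; apply: eq_bigr => j _; rewrite -!mulr_suml -hr.
    by congr (_ * _); apply: eq_bigr => i _; rewrite mulrC.
  have e : \sum_i \sum_j u i j * (r j - p i) = 0.
    under eq_bigr do under eq_bigr do rewrite mulrBr.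
    under eq_bigr do rewrite sumrB -[X in _ - X]mulr_suml hI mul1r.
    rewrite sumrB exchange_big /=.
    under eq_bigr do rewrite -mulr_suml hJ mul1r -hr.
    rewrite exchange_big /= -sumrB big1 // => i _.
    by rewrite -mulr_sumr hI mulr1 subrr.
  transitivity (\sum_i \sum_j u i j * (r j - p i) -
    (\sum_i \sum_j u i j * p i * ln (r j) - \sum_i \sum_j u i j * p i * ln (p i))).
    rewrite -!sumrB; apply: eq_bigr => i _; rewrite -!sumrB; apply: eq_bigr => j _.
    by rewrite /g; ring.
  by rewrite e sub0r opprB.
split.
  by rewrite -subr_ge0 -sg; apply: sumr_ge0 => i _; apply: sumr_ge0.
move=> e i j; move: sg; rewrite e subrr => sg.
have /(psumr_eq0P (fun j _ => g0 i j)) gi : \sum_j g i j = 0.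
  by move: sg => /psumr_eq0P -> // k _; apply: sumr_ge0.
have := gi j isT.
rewrite /g; have [->|un] := eqVneq (u i j) 0; first by left.
have up : 0 < u i j by rewrite lt_def un u0.
move=> hg; right; move: hg; have [->|pn] := eqVneq (p i) 0.
  by rewrite mulr0 mul0r !subr0 => /eqP; rewrite mulf_eq0 (negbTE un) => /eqP.
have pp : 0 < p i by rewrite lt_def pn p0.
have rp := rpos _ _ up pp.
rewrite -mulrA -mulrBr => /eqP; rewrite mulf_eq0 (negbTE un) /= subr_eq0 eq_sym => /eqP.
exact: mul_ln_div_eq.
Qed.
End RealEntropy.

(** * Entropy of positive semidefinite operators *)

Section QuantumEntropy.
Variable R : realType.
Local Notation C := R[i].

Definition orthobasis (I A : finType) (phi : A -> I -> C) :=
  (forall k l, \sum_a phi a k * (phi a l)^* = (k == l)%:R) /\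
  (forall a b, \sum_k phi a k * (phi b k)^* = (a == b)%:R).

Lemma rmorph_sqn (I : finType) (z : I -> C) : (\sum_i sqn (z i))%:C = \sum_i z i * (z i)^*.
Proof. by rewrite rmorph_sum /=; apply: eq_bigr => i _; rewrite sqnE. Qed.

Lemma mul_sum_conj (I J : finType) (x : I -> C) (y : J -> C) :
  (\sum_i x i) * (\sum_j y j)^* = \sum_i \sum_j x i * (y j)^*.
Proof.
by rewrite rmorph_sum mulr_suml; apply: eq_bigr => i _; rewrite mulr_sumr.
Qed.

Lemma orthobasis_parseval (I A : finType) (phi : A -> I -> C) (g : A -> C) :
  orthobasis phi -> \sum_k sqn (\sum_a (phi a k)^* * g a) = \sum_a sqn (g a).
Proof.
move=> [_ o2]; apply: (@complexI R); rewrite !rmorph_sqn.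
transitivity (\sum_a \sum_b (\sum_k phi b k * (phi a k)^*) * (g a * (g b)^*)).
  under eq_bigr => k _.
    rewrite mul_sum_conj; over.
  rewrite exchange_big /=; apply: eq_bigr => a _.
  rewrite exchange_big /=; apply: eq_bigr => b _.
  rewrite mulr_suml; apply: eq_bigr => k _.
  by rewrite rmorphM /= conjCK; ring.
apply: eq_bigr => a _; rewrite -(sum_deltal (fun b => g a * (g b)^*) a).
by apply: eq_bigr => b _; rewrite o2.
Qed.

Lemma sqnM (z w : C) : sqn (z * w) = sqn z * sqn w.
Proof. by apply: (@complexI R); rewrite rmorphM /= !sqnE rmorphM; ring. Qed.

Lemma sqnJ (z : C) : sqn (z^*) = sqn z.
Proof. by apply: (@complexI R); rewrite !sqnE conjCK mulrC. Qed.

Lemma sqnRC (x : R) : sqn (x%:C) = x ^+ 2.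
Proof. by apply: (@complexI R); rewrite sqnE conjRC -rmorphM expr2. Qed.

Lemma sqn_eq0 (z : C) : sqn z = 0 -> z = 0.
Proof. by move=> /(congr1 (real_complex R)); rewrite sqnE => /eqP;
    rewrite mul_conjC_eq0 => /eqP. Qed.

Lemma sqn0 : sqn (0 : C) = 0.
Proof. by rewrite /sqn mul0r. Qed.

(** The vectors [phi] scaled by [sqrt p] are orthogonal columns of a Gram factor of [rho]. *)
Lemma vN_entropy_spectral (I A : finType) (rho : op R A) (p : I -> R) (phi : A -> I -> C) :
  (forall k, 0 <= p k) -> (forall k l, \sum_a phi a k * (phi a l)^* = (k == l)%:R) ->
  (forall a b, rho a b = \sum_k (p k)%:C * (phi a k * (phi b k)^*)) ->
  vN_entropy rho = - \sum_k eta (p k).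
Proof.
move=> p0 o1 hr.
rewrite -(@vN_entropy_gram_diag R I A (fun a k => phi a k * (Num.sqrt (p k))%:C)).
  apply: vN_entropy_ext => a b; rewrite hr /gram; apply: eq_bigr => k _.
  rewrite rmorphM /= conjRC -{1}(sqr_sqrtr (p0 k)) rmorphXn /=; ring.
move=> k l; transitivity ((Num.sqrt (p k))%:C * (Num.sqrt (p l))%:C * (k == l)%:R).
  rewrite -o1 mulr_sumr; apply: eq_bigr => a _.
  by rewrite rmorphM /= conjRC; ring.
have [<-|] := eqVneq k l; last by rewrite !mulr0.
by rewrite !mulr1 -{3}(sqr_sqrtr (p0 k)) rmorphXn expr2.
Qed.

Lemma psd_gram (I A : finType) (T : A -> I -> C) : psd (gram T).
Proof.
move=> v.
have -> : \sum_a \sum_b (v a)^* * gram T a b * v b = \sum_i (\sum_a (v a)^* * T a i) *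
    (\sum_a (v a)^* * T a i)^*.
  under eq_bigr => a _.
    under eq_bigr => b _ do rewrite /gram mulr_sumr mulr_suml.
    rewrite exchange_big /=; over.
  rewrite exchange_big /=; apply: eq_bigr => i _.
  rewrite mul_sum_conj; apply: eq_bigr => a _.
  by apply: eq_bigr => b _; rewrite rmorphM /= conjCK; ring.
by apply: sumr_ge0 => i _; rewrite mul_conjC_ge0.
Qed.

Lemma psd_gramP (A : finType) (rho : op R A) : psd rho ->
  exists G : A -> A -> C, forall a b, rho a b = gram G a b.
Proof.
move=> /psd_spectral [p [phi [p0 _ _ hr]]].
exists (fun a k => phi a k * (Num.sqrt (p k))%:C) => a b.
rewrite hr /gram; apply: eq_bigr => k _.
rewrite rmorphM /= conjRC -{1}(sqr_sqrtr (p0 k)) rmorphXn /=; ring.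
Qed.

Definition diag (A : finType) (rho : op R A) (a : A) : R := complex.Re (rho a a).

Lemma diagE (A : finType) (rho : op R A) a : psd rho -> (diag rho a)%:C = rho a a.
Proof. by move=> h; rewrite /diag RRe_real // ger0_real // psd_diag_ge0. Qed.

Lemma diag_gram (I A : finType) (T : A -> I -> C) a : diag (gram T) a = \sum_i sqn (T a i).
Proof. by apply: (@complexI R); rewrite diagE ?rmorph_sqn //; exact: psd_gram. Qed.

(** The diagonal is the image of the spectrum under the doubly stochastic matrix of squared moduli
    of eigenvector entries. *)
Lemma vN_entropy_diag_le (A : finType) (rho : op R A) : psd rho ->
  vN_entropy rho <= - \sum_a eta (diag rho a) /\
  forall a b, a != b -> rho a b != 0 -> vN_entropy rho < - \sum_a eta (diag rho a).
Proof.
move=> hr; have [p [phi [p0 o1 o2 hs]]] := psd_spectral hr.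
rewrite (vN_entropy_spectral p0 o1 hs) !sum_eta.
have [] := @shannon_doubly_stochastic R A A (fun k a => sqn (phi a k)) p (diag rho).
- by move=> k a; exact: sqn_ge0.
- by [].
- by move=> k; apply: (@complexI R); rewrite rmorph_sqn o1 eqxx.
- by move=> a; apply: (@complexI R); rewrite rmorph_sqn o2 eqxx.
- move=> a; apply: (@complexI R); rewrite diagE // hs rmorph_sum /=.
  by apply: eq_bigr => k _; rewrite rmorphM /= sqnE.
move=> hle heq; have l2 := ln2_gt0 R.
split; first by rewrite lerN2 ler_pM2r ?invr_gt0.
move=> a b ab; apply: contra_neqT; rewrite ltrN2 ltr_pM2r ?invr_gt0 // lt_neqAle hle andbT negbK
    => /eqP.
move/heq => h; rewrite hs.
(* In the equality case every eigenvector charging [a] has eigenvalue [diag rho a]; this constant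
   factors out, and completeness makes the entry at [a != b] vanish. *)
rewrite (eq_bigr (fun k => (diag rho a)%:C * (phi a k * (phi b k)^*))).
  by rewrite -mulr_sumr o2 (negbTE ab) mulr0.
move=> k _; have [/sqn_eq0 ->|->//] := h k a.
by rewrite mul0r !mulr0.
Qed.

Lemma vN_entropy_rotate (A : finType) (rho : op R A) (chi : A -> A -> C) :
  psd rho -> orthobasis chi ->
  vN_entropy (fun j l => \sum_a \sum_b (chi a j)^* * rho a b * chi b l) = vN_entropy rho.
Proof.
move=> hr [_ o2]; have [p [phi [p0 o1 o2' hs]]] := psd_spectral hr.
rewrite (vN_entropy_spectral p0 o1 hs).
apply: (@vN_entropy_spectral A A _ p (fun j k => \sum_a (chi a j)^* * phi a k)) => //.
  move=> k l; rewrite -o1.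
  transitivity (\sum_a \sum_b (\sum_j chi b j * (chi a j)^*) * (phi a k * (phi b l)^*)).
    under eq_bigr => j _.
      rewrite mul_sum_conj; over.
    rewrite exchange_big /=; apply: eq_bigr => a _.
    rewrite exchange_big /=; apply: eq_bigr => b _.
    rewrite mulr_suml; apply: eq_bigr => j _.
    by rewrite rmorphM /= conjCK; ring.
  apply: eq_bigr => a _; rewrite -(sum_deltal (fun b => phi a k * (phi b l)^*) a).
  by apply: eq_bigr => b _; rewrite o2.
move=> j l.
under eq_bigr => a _.
  under eq_bigr => b _ do rewrite hs mulr_sumr mulr_suml.
  rewrite exchange_big /=; over.
rewrite exchange_big /=; apply: eq_bigr => k _.
rewrite mul_sum_conj mulr_sumr; apply: eq_bigr => a _.
rewrite mulr_sumr; apply: eq_bigr => b _.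
by rewrite rmorphM /= conjCK; ring.
Qed.

Lemma trace_spectral (A : finType) (rho : op R A) (p : A -> R) (phi : A -> A -> C) :
  (forall k l, \sum_a phi a k * (phi a l)^* = (k == l)%:R) ->
  (forall a b, rho a b = \sum_k (p k)%:C * (phi a k * (phi b k)^*)) ->
  trace rho = (\sum_k p k)%:C.
Proof.
move=> o1 hs; rewrite /trace; under eq_bigr do rewrite hs.
rewrite exchange_big rmorph_sum /=; apply: eq_bigr => k _.
by rewrite -mulr_sumr o1 eqxx mulr1.
Qed.

Lemma vN_entropy_ge0 (A : finType) (rho : op R A) : density rho -> 0 <= vN_entropy rho.
Proof.
move=> [/psd_spectral [p [phi [p0 o1 _ hs]]]].
rewrite (trace_spectral o1 hs) => /(@complexI R _ 1) p1.
rewrite (vN_entropy_spectral p0 o1 hs) oppr_ge0; apply: sumr_le0 => k _.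
rewrite /eta /log2 mulrA pmulr_lle0 ?invr_gt0 ?ln2_gt0 // mulr_ge0_le0 // ln_le0 //.
by rewrite -p1 (bigD1 k) //= lerDl sumr_ge0.
Qed.

Lemma vN_entropy_le_card (A : finType) (rho : op R A) :
  density rho -> vN_entropy rho <= log2 #|A|%:R.
Proof.
move=> [/psd_spectral [p [phi [p0 o1 _ hs]]]].
rewrite (trace_spectral o1 hs) => /(@complexI R _ 1) p1.
rewrite (vN_entropy_spectral p0 o1 hs) sum_eta -mulNr ler_pM2r ?invr_gt0 ?ln2_gt0 //.
have A0 : (0 < #|A|)%N.
  rewrite lt0n; apply/eqP => A0; have /eqP := p1; rewrite big1 1?eq_sym ?oner_eq0 // => k _.
  by move: (fintype0 k A0).
have N0 : 0 < #|A|%:R :> R by rewrite ltr0n.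
rewrite -[leRHS]mul1r -[X in X * _]p1 mulr_suml -sumrN -subr_ge0 -sumrB.
(* Writing 0 as the sum of [p k - 1 / #|A|] turns the claim into a termwise inequality. *)
rewrite -[leLHS](_ : \sum_(k : A) (p k - #|A|%:R^-1) = 0); last first.
  by rewrite sumrB p1 sumr_const -[X in _ - X]mulr_natl divff ?subrr // gt_eqF.
have iN : 0 < #|A|%:R^-1 :> R by rewrite invr_gt0.
apply: ler_sum => k _; have [->|pn] := eqVneq (p k) 0; first by rewrite !mul0r; lra.
have pp : 0 < p k by rewrite lt_def pn p0.
have := mul_ln_div_le pp iN; rewrite lnV ?posrE // mulrBr mulrN.
set x := p k * ln #|A|%:R; set y := p k * ln (p k); set z := _^-1; lra.
Qed.

(** The bijection [f] allows products that are not literally pairs, such as functions on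
    ['I_(m + n)] cut into two blocks. *)
Lemma vN_entropy_tensor (X A B : finType) (f : X -> A * B) (tau : op R X) (rho : op R A) (sigma :
    op R B) :
  bijective f -> density rho -> density sigma ->
  (forall x y, tau x y = rho (f x).1 (f y).1 * sigma (f x).2 (f y).2) ->
  vN_entropy tau = vN_entropy rho + vN_entropy sigma.
Proof.
move=> [g fK gK] [/psd_spectral [p [phi [p0 o1 _ hr]]] tr] [/psd_spectral [q [psi [q0 u1 _ hs]]]
    ts] ht.
have p1 : \sum_k p k = 1 by apply: (@complexI R); rewrite -(trace_spectral o1 hr).
have q1 : \sum_k q k = 1 by apply: (@complexI R); rewrite -(trace_spectral u1 hs).
rewrite (vN_entropy_spectral p0 o1 hr) (vN_entropy_spectral q0 u1 hs).
rewrite (@vN_entropy_spectral (A * B)%type X tau (fun k => p k.1 * q k.2)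
  (fun x k => phi (f x).1 k.1 * psi (f x).2 k.2)).
- rewrite -opprD; congr (- _); rewrite -(pair_bigA _ (fun k l => eta (p k * q l))) /=.
  (* [eta] obeys the Leibniz rule, also at 0; summing over normalised [p] and [q] gives
     additivity. *)
  have etaM x y : 0 <= x -> 0 <= y -> eta (x * y) = eta x * y + x * eta y :> R.
    move=> x0 y0; have [->|xn] := eqVneq x 0; first by rewrite !mul0r eta0 mul0r addr0.
    have [->|yn] := eqVneq y 0; first by rewrite !mulr0 eta0 mulr0 addr0.
    by rewrite /eta /log2 lnM ?posrE ?lt_def ?xn ?yn //; ring.
  under eq_bigr do under eq_bigr do rewrite etaM //.
  under eq_bigr do rewrite big_split /= -mulr_sumr q1 mulr1 -mulr_sumr.
  by rewrite big_split /= -mulr_suml p1 mul1r.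
- by move=> k; rewrite mulr_ge0.
- move=> k l; rewrite (reindex g) /=; last by exists f => x _; rewrite ?gK ?fK.
  under eq_bigr do rewrite gK.
  rewrite -(pair_bigA _ (fun a b => phi a k.1 * psi b k.2 * (phi a l.1 * psi b l.2)^*)) /=.
  transitivity ((k.1 == l.1)%:R * (k.2 == l.2)%:R : C).
    rewrite -o1 -u1 mulr_suml; apply: eq_bigr => a _; rewrite mulr_sumr; apply: eq_bigr => b _.
    by rewrite rmorphM; ring.
  by case: k l => [k1 k2] [l1 l2]; rewrite -natrM mulnb.
- move=> x y; rewrite ht hr hs mulr_suml.
  rewrite -(pair_bigA _ (fun k l => (p k * q l)%:C * (phi (f x).1 k * psi (f x).2 l *
      (phi (f y).1 k * psi (f y).2 l)^*))) /=.
  apply: eq_bigr => k _; rewrite mulr_sumr; apply: eq_bigr => l _.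
  by rewrite !rmorphM /=; ring.
Qed.
End QuantumEntropy.

(** * Bounds on the coherent information *)

Section CoherentInformation.
Variable R : realType.
Local Notation C := R[i].

(** [T] holds the amplitudes of a pure vector on reference [Q], output [B] and environment [E]; this
    operator and the next are its reduced states on [B] and [E]. *)
Definition coherent_out (Q E B : finType) (T : Q -> B -> E -> C) : op R B :=
  gram (fun b (z : Q * E) => T z.1 b z.2).
Definition coherent_env (Q E B : finType) (T : Q -> B -> E -> C) : op R E :=
  gram (fun e (z : Q * B) => T z.1 z.2 e).

Lemma gram_form (B K : finType) (X : B -> K -> C) (v : B -> C) :
  \sum_k (\sum_b v b * X b k) * (\sum_b v b * X b k)^* = \sum_a \sum_b v a * gram X a b * (v b)^*.
Proof.
under eq_bigr => k _.
  rewrite mul_sum_conj; over.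
rewrite exchange_big /=; apply: eq_bigr => a _.
rewrite exchange_big /=; apply: eq_bigr => b _.
rewrite /gram mulr_sumr mulr_suml; apply: eq_bigr => k _.
by rewrite rmorphM; ring.
Qed.

Lemma gram_eigen_form (A B K : finType) (X : B -> K -> C) (q : A -> R) (chi : B -> A ->
    C) (v : B -> C) :
  (forall a b, gram X a b = \sum_k (q k)%:C * (chi a k * (chi b k)^*)) ->
  \sum_k sqn (\sum_b v b * X b k) = \sum_j q j * sqn (\sum_b v b * chi b j).
Proof.
move=> h; apply: (@complexI R); rewrite rmorph_sqn gram_form rmorph_sum /=.
under [RHS]eq_bigr => j _.
  rewrite rmorphM /= sqnE mul_sum_conj mulr_sumr.
  under eq_bigr do rewrite mulr_sumr.
  over.
rewrite [RHS]exchange_big /=; apply: eq_bigr => a _.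
rewrite [RHS]exchange_big /=; apply: eq_bigr => b _.
rewrite h mulr_sumr mulr_suml; apply: eq_bigr => k _.
by rewrite rmorphM; ring.
Qed.

(* The hypothesis says that the joint state of Q and B is dominated by 1 (x) gram X.  In the
   eigenbases of the environment state (eigenvalues p) and of gram X (eigenvalues q) it gives the
   weights w i j of the joint eigenvectors the bound sum_j w i j / q j <= 1, and
   ln x <= x - 1 does the rest; this replaces the operator monotonicity of the logarithm. *)
Lemma coherent_le (Q E B K : finType) (T : Q -> B -> E -> C) (X : B -> K -> C) (c : R) :
  (forall u : Q -> B -> C,
    \sum_e sqn (\sum_r \sum_b (u r b)^* * T r b e) <= \sum_r \sum_k sqn (\sum_b (u r b)^* *
        X b k)) ->
  \sum_r \sum_b \sum_e sqn (T r b e) = 1 ->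
  0 < c -> \sum_b \sum_k sqn (X b k) <= c ->
  vN_entropy (coherent_out T) - vN_entropy (coherent_env T) <= log2 c.
Proof.
move=> hT t1 c0 hc.
have [p [phi [p0 o1 o2 hE]]] := psd_spectral (psd_gram (fun e (z : Q * B) => T z.1 z.2 e)).
have [q [chi [q0 u1 u2 hS]]] := psd_spectral (psd_gram X).
have ophi : orthobasis phi by [].
have ochi : orthobasis chi by [].
(* Components of [T] in the eigenbasis of the environment, then also in that of [gram X]. *)
pose t i r b := \sum_e (phi e i)^* * T r b e.
pose y i r j := \sum_b (chi b j)^* * t i r b.
(* The domination hypothesis transported to these eigenbases, where [gram X] acts as multiplication
   by [q]. *)
have hY (u : Q -> B -> C) :
    \sum_i sqn (\sum_r \sum_j (u r j)^* * y i r j) <= \sum_r \sum_j q j * sqn (u r j).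
  pose v r b := \sum_j chi b j * u r j.
  have vu r j : \sum_b (chi b j)^* * v r b = u r j.
    transitivity (\sum_k (\sum_b chi b k * (chi b j)^*) * u r k).
      under eq_bigr do rewrite mulr_sumr.
      rewrite exchange_big; apply: eq_bigr => k _; rewrite mulr_suml.
      by apply: eq_bigr => b _; ring.
    rewrite -[RHS](sum_deltal (u r) j); apply: eq_bigr => k _.
    by rewrite u1.
  have := hT v; congr (_ <= _).
    rewrite -(orthobasis_parseval _ ophi); apply: eq_bigr => i _; congr sqn.
    under eq_bigr do rewrite mulr_sumr.
    rewrite exchange_big; apply: eq_bigr => r _.
    under eq_bigr do rewrite mulr_sumr.
    rewrite exchange_big /=.
    transitivity (\sum_b (v r b)^* * t i r b).
      by apply: eq_bigr => b _; rewrite mulr_sumr; apply: eq_bigr => e _; ring.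
    transitivity (\sum_b \sum_j (chi b j * u r j)^* * t i r b).
      by apply: eq_bigr => b _; rewrite /v rmorph_sum mulr_suml.
    rewrite exchange_big; apply: eq_bigr => j _; rewrite mulr_sumr.
    by apply: eq_bigr => b _; rewrite rmorphM /=; ring.
  apply: eq_bigr => r _; rewrite (gram_eigen_form _ hS); apply: eq_bigr => j _.
  rewrite -(sqnJ (u r j)) -(vu r j) rmorph_sum; congr (_ * sqn _); apply: eq_bigr => b _.
  by rewrite rmorphM /= conjCK mulrC.
pose w i j := \sum_r sqn (y i r j).
have w0 i j : 0 <= w i j by apply: sumr_ge0 => r _; exact: sqn_ge0.
pose rho : op R B := fun j l => \sum_a \sum_b (chi a j)^* * coherent_out T a b * chi b l.
have rhoE : rho = gram (fun j (z : Q * E) => \sum_b (chi b j)^* * T z.1 b z.2).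
  apply/funext => j; apply/funext => l; rewrite /rho /coherent_out /gram.
  under [RHS]eq_bigr => z _.
    rewrite mul_sum_conj; over.
  rewrite [RHS]exchange_big /=; apply: eq_bigr => a _.
  rewrite [RHS]exchange_big /=; apply: eq_bigr => b _.
  rewrite mulr_sumr mulr_suml; apply: eq_bigr => z _.
  by rewrite rmorphM /= conjCK; ring.
have wr j : \sum_i w i j = diag rho j.
  rewrite rhoE diag_gram -(pair_bigA _ (fun r e => sqn (\sum_b (chi b j)^* * T r b e))) /=.
  rewrite exchange_big; apply: eq_bigr => r _.
  rewrite -(orthobasis_parseval (fun e => \sum_b (chi b j)^* * T r b e) ophi);
      apply: eq_bigr => i _; congr sqn.
  rewrite /y /t; under eq_bigr do rewrite mulr_sumr.
  rewrite exchange_big; apply: eq_bigr => e _; rewrite mulr_sumr.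
  by apply: eq_bigr => b _; ring.
have wp i : \sum_j w i j = p i.
  rewrite exchange_big /=.
  transitivity (\sum_r \sum_b sqn (t i r b)).
    by apply: eq_bigr => r _; rewrite (orthobasis_parseval _ ochi).
  rewrite pair_bigA /= /t (gram_eigen_form (fun e => (phi e i)^*) hE).
  rewrite -[RHS](sum_deltal p i); apply: eq_bigr => j _.
  have -> : \sum_a (phi a i)^* * phi a j = (j == i)%:R.
    by rewrite -o1; apply: eq_bigr => a _; rewrite mulrC.
  have -> : (j == i)%:R = ((j == i)%:R : R)%:C by rewrite rmorph_nat.
  by rewrite sqnRC mulrC; case: (j == i); rewrite ?expr1n ?expr0n.
(* Only one environment eigenvector is kept, so that test vectors can be adapted to it. *)
have one i0 (u : Q -> B -> C) :
    sqn (\sum_r \sum_j (u r j)^* * y i0 r j) <= \sum_r \sum_j q j * sqn (u r j).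
  apply: le_trans (hY u); rewrite (bigD1 i0) //= lerDl.
  by apply: sumr_ge0 => i _; exact: sqn_ge0.
have wq i : \sum_j w i j / q j <= 1.
  (* With m the left-hand side, testing on y i r j / q j yields m ^ 2 <= m; a zero q j contributes
     0 because 0^-1 = 0. *)
  set m := \sum_j _; have m0 : 0 <= m by apply: sumr_ge0 => j _; rewrite divr_ge0.
  have := one i (fun r j => (q j)^-1%:C * y i r j).
  rewrite (_ : \sum_r \sum_j ((q j)^-1%:C * y i r j)^* * y i r j = m%:C); last first.
    rewrite exchange_big /m rmorph_sum; apply: eq_bigr => j _ /=.
    rewrite /w mulr_suml rmorph_sum; apply: eq_bigr => r _ /=.
    by rewrite !rmorphM /= sqnE conjRC; ring.
  rewrite (_ : \sum_r _ = m); last first.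
    rewrite exchange_big /m; apply: eq_bigr => j _ /=.
    rewrite /w mulr_suml; apply: eq_bigr => r _ /=.
    rewrite sqnM sqnRC; have [->|qn] := eqVneq (q j) 0; first by rewrite mul0r invr0 mulr0.
    by field.
  rewrite sqnRC => m2; have [->|mn] := eqVneq m 0; first exact: ler01.
  have mp : 0 < m by rewrite lt_def mn.
  by rewrite -(ler_pM2r mp) mul1r -expr2.
(* A test vector supported on [j] makes the right-hand side 0 and the left-hand side [w i j ^ 2]. *)
have wz i j : q j = 0 -> w i j = 0.
  move=> qj; have := one i (fun r l => (l == j)%:R * y i r j).
  rewrite [X in _ <= X]big1; last first.
    move=> r _; apply: big1 => l _; case: eqVneq => [->|_]; first by rewrite qj mul0r.
    by rewrite mul0r sqn0 mulr0.
  rewrite (_ : \sum_r _ = (w i j)%:C); last first.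
    rewrite /w rmorph_sqn; apply: eq_bigr => r _.
    rewrite -[RHS](sum_deltal (fun l => y i r l * (y i r j)^*) j); apply: eq_bigr => l _.
    by rewrite rmorphM /= conjC_nat; ring.
  rewrite sqnRC => w2; apply/eqP; rewrite -sqrf_eq0 eq_le w2 sqr_ge0 //.
have qc : \sum_j q j <= c.
  apply: le_trans hc; rewrite le_eqVlt; apply/orP; left; apply/eqP.
  apply: (@complexI R); rewrite -(trace_spectral u1 hS) rmorph_sum; apply: eq_bigr => b _ /=.
  by rewrite rmorph_sqn.
have p1 : \sum_i p i = 1.
  apply: (@complexI R); rewrite -(trace_spectral o1 hE) -t1.
  rewrite /trace (eq_bigr (fun e => (\sum_r \sum_b sqn (T r b e))%:C)); last first.
    by move=> e _; rewrite /gram -rmorph_sqn pair_bigA.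
  rewrite -rmorph_sum; congr (_ %:C); rewrite exchange_big; apply: eq_bigr => r _.
  by rewrite exchange_big.
have prho : psd rho by rewrite rhoE; exact: psd_gram.
(* Dephasing the output in the eigenbasis of [gram X] can only raise its entropy, and the dephased
   spectrum is the marginal of [w]. *)
have [hB _] := vN_entropy_diag_le prho.
rewrite vN_entropy_rotate // in hB; last exact: psd_gram.
rewrite (vN_entropy_spectral p0 o1 hE) opprK.
apply: le_trans (lerD hB (lexx _)) _.
rewrite !sum_eta addrC -mulrBl /log2 ler_pM2r ?invr_gt0 ?ln2_gt0 //.
exact: (sum_shannon_le w0 q0 wp wr wq wz qc c0 p1).
Qed.
End CoherentInformation.

(** * Domination obtained from the partial transpose *)

Section TranspositionBound.
Variable R : realType.
Local Notation C := R[i].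

Lemma Re_sum (I : finType) (F : I -> C) : complex.Re (\sum_i F i) = \sum_i complex.Re (F i).
Proof. by apply: (big_morph (@complex.Re R)) => // -[? ?] [? ?]. Qed.

Lemma Re_mulC_le (eps : R) (x y : C) : `|eps| <= 1 ->
  complex.Re (eps%:C * (x * y^*)) <= (sqn x + sqn y) / 2.
Proof.
rewrite ler_norml => /andP[e1 e2].
case: x => a b; case: y => c d; rewrite /sqn /=.
(* The certificate for [nra]: [|x - eps y| ^ 2 >= 0] together with [(1 - eps ^ 2) |y| ^ 2 >= 0]. *)
have h1 := sqr_ge0 (a - eps * c); have h2 := sqr_ge0 (b - eps * d).
have h3 : 0 <= (1 - eps ^+ 2) * (c ^+ 2 + d ^+ 2).
  have -> : 1 - eps ^+ 2 = (1 - eps) * (1 + eps) by ring.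
  apply: mulr_ge0; last by rewrite addr_ge0 ?sqr_ge0.
  by apply: mulr_ge0; lra.
have e : eps * (a * c - b * - d) - 0 * (a * - d + b * c) = a * (eps * c) + b * (eps * d) by ring.
nra.
Qed.

Section Bound.
Variables (N : chan R) (K : finType) (eps : K -> R) (h : K -> chA N -> chB N -> C).

(* The partial transpose (in the input) of the Choi matrix of N is sum_k eps k |h k><h k|. *)
Definition transpose_decomp :=
  forall a a' b b', \sum_e chV (b, e) a * (chV (b', e) a')^* =
    \sum_k (eps k)%:C * (h k a' b * (h k a b')^*).

(* Tracing out the output of sum_k |h k><h k| leaves the diagonal operator D. *)
Definition transpose_weight (D : chA N -> R) :=
  forall a a', \sum_k \sum_b h k a b * (h k a' b)^* = (D a)%:C * (a == a')%:R.

Lemma transpose_weight_ge0 D a : transpose_weight D -> 0 <= D a.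
Proof.
move=> /(_ a a); rewrite eqxx mulr1 => e; rewrite -ler0c -e.
by apply: sumr_ge0 => k _; apply: sumr_ge0 => b _; rewrite mul_conjC_ge0.
Qed.

(** The isometry applied to the purification [G]: a vector on reference, output and environment. *)
Definition channel_map (Q : finType) (G : chA N -> Q -> C) (r : Q) (b : chB N) (e : chE N) : C :=
  \sum_a chV (b, e) a * G a r.

Lemma apply_chan_gram (Q : finType) (G : chA N -> Q -> C) b b' :
  @apply_chan R N (gram G) b b' = coherent_out (channel_map G) b b'.
Proof.
rewrite /apply_chan /ptrE /conj_map /coherent_out /gram.
rewrite -(pair_bigA _ (fun r e => channel_map G r b e * (channel_map G r b' e)^*)) /=.
rewrite [RHS]exchange_big /=; apply: eq_bigr => e _.
under [RHS]eq_bigr => r _.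
  rewrite /channel_map mul_sum_conj; over.
rewrite [RHS]exchange_big /=; apply: eq_bigr => a _.
rewrite [RHS]exchange_big /=; apply: eq_bigr => a' _.
rewrite mulr_sumr mulr_suml; apply: eq_bigr => r _.
by rewrite rmorphM /=; ring.
Qed.

Lemma apply_comp_gram (Q : finType) (G : chA N -> Q -> C) e e' :
  @apply_comp R N (gram G) e e' = coherent_env (channel_map G) e e'.
Proof.
rewrite /apply_comp /ptrB /conj_map /coherent_env /gram.
rewrite -(pair_bigA _ (fun r b => channel_map G r b e * (channel_map G r b e')^*)) /=.
rewrite [RHS]exchange_big /=; apply: eq_bigr => b _.
under [RHS]eq_bigr => r _.
  rewrite /channel_map mul_sum_conj; over.
rewrite [RHS]exchange_big /=; apply: eq_bigr => a _.
rewrite [RHS]exchange_big /=; apply: eq_bigr => a' _.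
rewrite mulr_sumr mulr_suml; apply: eq_bigr => r _.
by rewrite rmorphM /=; ring.
Qed.

Definition isometric := forall a a' : chA N,
  \sum_(b : chB N) \sum_(e : chE N) chV (b, e) a * (chV (b, e) a')^* = (a == a')%:R :> C.

Lemma trace_channel_map (Q : finType) (G : chA N -> Q -> C) : isometric ->
  (\sum_r \sum_b \sum_e sqn (channel_map G r b e))%:C = trace (gram G).
Proof.
move=> hV; rewrite /trace /gram [RHS]exchange_big /= rmorph_sum; apply: eq_bigr => r _ /=.
rewrite pair_bigA rmorph_sqn /=.
under eq_bigr => z _.
  rewrite /channel_map mul_sum_conj; over.
rewrite exchange_big /=; apply: eq_bigr => a _.
rewrite exchange_big /= -(sum_deltal (fun a' => G a r * (G a' r)^*) a); apply: eq_bigr => a' _.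
rewrite eq_sym -hV pair_bigA /= mulr_suml; apply: eq_bigr => -[b e] _ /=.
by rewrite rmorphM /=; ring.
Qed.

Lemma transpose_bound (D : chA N -> R) (c : R) (rho : op R (chA N)) : transpose_decomp ->
    (forall k, `|eps k| <= 1) ->
  transpose_weight D -> (forall a, D a <= c) -> 0 < c -> isometric -> density rho ->
  vN_entropy (@apply_chan R N rho) - vN_entropy (@apply_comp R N rho) <= log2 c.
Proof.
move=> hd he hw hD c0 hV [/psd_gramP [G hG] tr].
have {hG} rG : rho = gram G by apply/funext => a; apply/funext => b.
rewrite rG in tr *.
rewrite (vN_entropy_ext (apply_chan_gram G)) (vN_entropy_ext (apply_comp_gram G)).
(* [gram X] is the operator sigma that dominates the joint state. *)
pose X b (z : K * chA N) : C := \sum_a h z.1 a b * (G a z.2)^*.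
apply: (@coherent_le R _ _ _ _ (channel_map G) X c) => //.
- move=> u; pose f k r r' := \sum_b (u r b)^* * X b (k, r').
  (* The effect of the transpose: in [f k r r'] the test vector carries [r] and the input [r'], and
     the conjugate factor has them exchanged. *)
  have key r r' : \sum_e (\sum_b (u r b)^* * channel_map G r b e) * (\sum_b (u r' b)^* *
      channel_map G r' b e)^* =
      \sum_k (eps k)%:C * (f k r r' * (f k r' r)^*).
    transitivity (\sum_b \sum_b' \sum_a \sum_a' (u r b)^* * u r' b' * G a r * (G a' r')^* *
       (\sum_e chV (b, e) a * (chV (b', e) a')^*)).
      under eq_bigr => e _.
        rewrite mul_sum_conj; over.
      rewrite exchange_big /=; apply: eq_bigr => b _.
      rewrite exchange_big /=; apply: eq_bigr => b' _.
      transitivity (\sum_e \sum_a \sum_a' (u r b)^* * u r' b' * ((chV (b, e) a * G a r) *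
          (chV (b', e) a' * G a' r')^*)).
        apply: eq_bigr => e _; rewrite rmorphM /= conjCK.
        rewrite mulrACA /channel_map mul_sum_conj mulr_sumr; apply: eq_bigr => a _.
        by rewrite mulr_sumr.
      rewrite exchange_big /=; apply: eq_bigr => a _.
      rewrite exchange_big /=; apply: eq_bigr => a' _.
      rewrite mulr_sumr; apply: eq_bigr => e _.
      by rewrite !rmorphM /=; ring.
    under [RHS]eq_bigr => k _.
      rewrite mul_sum_conj mulr_sumr.
      under eq_bigr do rewrite mulr_sumr.
      over.
    rewrite [RHS]exchange_big /=; apply: eq_bigr => b _.
    rewrite [RHS]exchange_big /=; apply: eq_bigr => b' _.
    transitivity (\sum_k \sum_a' \sum_a (eps k)%:C * ((u r b)^* * u r' b') *
        ((h k a' b * (G a' r')^*) * (h k a b' * (G a r)^*)^*)); last first.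
      apply: eq_bigr => k _; rewrite rmorphM /= conjCK mulrACA /X mul_sum_conj mulr_sumr.
      rewrite mulr_sumr; apply: eq_bigr => a' _.
      by rewrite !mulr_sumr; apply: eq_bigr => a _; rewrite !mulrA.
    rewrite [RHS]exchange_big [LHS]exchange_big /=; apply: eq_bigr => a' _.
    rewrite [RHS]exchange_big /=; apply: eq_bigr => a _.
    rewrite hd mulr_sumr; apply: eq_bigr => k _.
    by rewrite !rmorphM /= !conjCK; ring.
  have e1 : \sum_e sqn (\sum_r \sum_b (u r b)^* * channel_map G r b e) =
      \sum_r \sum_r' \sum_k complex.Re ((eps k)%:C * (f k r r' * (f k r' r)^*)).
    transitivity (complex.Re (\sum_r \sum_r' \sum_k (eps k)%:C * (f k r r' * (f k r' r)^*)));
        last first.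
      by rewrite Re_sum; apply: eq_bigr => r _; rewrite Re_sum; apply: eq_bigr => r' _;
          rewrite Re_sum.
    rewrite -[LHS]/(complex.Re (_%:C)) rmorph_sqn; congr complex.Re.
    under eq_bigr => e _.
      rewrite mul_sum_conj; over.
    rewrite exchange_big /=; apply: eq_bigr => r _.
    rewrite exchange_big /=; apply: eq_bigr => r' _.
    exact: key.
  (* The bound of each term is half of [F r r' + F r' r]; summed over both indices the halves agree
     and give the form of 1 (x) sigma. *)
  rewrite e1; apply: (@le_trans _ _ (\sum_r \sum_r' \sum_k (sqn (f k r r') + sqn (f k r' r)) / 2)).
    by apply: ler_sum => r _; apply: ler_sum => r' _; apply: ler_sum => k _; exact: Re_mulC_le.
  pose F r r' := \sum_k sqn (f k r r').
  have -> : \sum_r \sum_r' \sum_k (sqn (f k r r') + sqn (f k r' r)) / 2 = \sum_r \sum_r' F r r'.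
    transitivity (\sum_r \sum_r' F r r' / 2 + \sum_r \sum_r' F r' r / 2).
      rewrite -big_split; apply: eq_bigr => r _; rewrite -big_split; apply: eq_bigr => r' _.
      by rewrite -mulr_suml big_split mulrDl.
    rewrite [X in _ + X]exchange_big -big_split; apply: eq_bigr => r _.
    by rewrite -big_split; apply: eq_bigr => r' _; rewrite /=; lra.
  apply: ler_sum => r _.
  by rewrite -(pair_bigA _ (fun k r' => sqn (\sum_b (u r b)^* * X b (k, r')))) exchange_big.
- by apply: (@complexI R); rewrite trace_channel_map.
(* The trace of sigma is the average of [D] over the diagonal of the input state, hence at most
   [c]. *)
- suff e : (\sum_b \sum_k sqn (X b k))%:C = (\sum_a D a * diag (gram G) a)%:C :> C.
    move: e => /(@complexI R) ->.
    apply: (@le_trans _ _ (\sum_a c * diag (gram G) a)).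
      apply: ler_sum => a _; apply: ler_wpM2r (hD a).
      by rewrite diag_gram; apply: sumr_ge0 => i _; exact: sqn_ge0.
    rewrite -mulr_sumr -Re_sum -/(trace (gram G)) tr mulr1 //.
  transitivity (\sum_r \sum_a \sum_a' (G a r)^* * G a' r * (\sum_k \sum_b h k a b * (h k a' b)^*)).
    rewrite pair_bigA rmorph_sqn /=.
    rewrite -(pair_bigA _ (fun b z => X b z * (X b z)^*)) /= exchange_big /=.
    rewrite -(pair_bigA _ (fun k r => \sum_b X b (k, r) * (X b (k, r))^*)) /= exchange_big /=.
    apply: eq_bigr => r _.
    transitivity (\sum_k \sum_b \sum_a \sum_a' (h k a b * (G a r)^*) * (h k a' b * (G a' r)^*)^*).
      by apply: eq_bigr => k _; apply: eq_bigr => b _; rewrite mul_sum_conj.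
    rewrite pair_bigA exchange_big /=; apply: eq_bigr => a _.
    rewrite exchange_big /=; apply: eq_bigr => a' _.
    rewrite pair_bigA mulr_sumr; apply: eq_bigr => z _ /=.
    by rewrite rmorphM /= conjCK; ring.
  rewrite exchange_big rmorph_sum; apply: eq_bigr => a _ /=.
  rewrite rmorphM /= diagE; last exact: psd_gram.
  rewrite /gram mulr_sumr; apply: eq_bigr => r _.
  rewrite (eq_bigr (fun a' => (a' == a)%:R * ((G a r)^* * G a' r * (D a)%:C))).
    by rewrite sum_deltal; ring.
  by move=> a' _; rewrite hw eq_sym; ring.
Qed.
End Bound.
End TranspositionBound.

(** * Regularisation *)

Section Fekete.
Variable R : realType.
Local Open Scope classical_set_scope.

(** Fekete's lemma with an explicit error: for fixed [N] the loss is a constant divided by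
    [n.+1]. *)
Lemma superadditive_ge (a : nat -> R) N n :
  (forall m n, a m + a n <= a (m + n)%N) ->
  a N.+1 / N.+1%:R - (a N.+1 - N.+1%:R * a 1%N) / n.+1%:R <= a n.+1 / n.+1%:R.
Proof.
(* The superadditive sequence b vanishes at 1, hence is nonnegative on positive indices. *)
move=> sa; pose b k := a k - k%:R * a 1%N.
have sb k l : b k + b l <= b (k + l)%N.
  by rewrite /b natrD mulrDl; have := sa k l; lra.
have b0 k : 0 <= b k.+1.
  elim: k => [|k IH]; first by rewrite /b mul1r subrr.
  have := sb 1%N k.+1; rewrite add1n; have : b 1%N = 0 by rewrite /b mul1r subrr.
  by lra.
have bq q r : q%:R * b N.+1 <= b (q * N.+1 + r.+1)%N.
  elim: q => [|q IH]; first by rewrite mul0r mul0n add0n b0.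
  rewrite mulSn -addnA; apply: le_trans (sb _ _).
  by rewrite -natr1 mulrDl mul1r addrC lerD2l.
have n0 : 0 < n.+1%:R :> R by rewrite ltr0n.
have N0 : 0 < N.+1%:R :> R by rewrite ltr0n.
(* Dividing [n] rather than [n.+1] leaves a remainder block of length [r.+1], never empty, where [b]
   is known to be nonnegative. *)
have := bq (n %/ N.+1)%N (n %% N.+1)%N; rewrite addnS -divn_eq => h.
have hq : n.+1%:R - N.+1%:R <= (n %/ N.+1)%:R * N.+1%:R :> R.
  by rewrite lerBlDr -natrM -natrD ler_nat addnC -mulSn ltn_ceil.
have h2 : (n.+1%:R - N.+1%:R) * (b N.+1 / N.+1%:R) <= b n.+1.
  apply: le_trans h; rewrite mulrA ler_pdivrMr // mulrAC ler_wpM2r // ?b0.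
rewrite -(ler_pM2r n0) -[leRHS]mulrA mulVf ?gt_eqF // mulr1 mulrBl -[X in _ - X]mulrA mulVf
    ?gt_eqF // mulr1.
move: h2; rewrite /b.
have -> : (n.+1%:R - N.+1%:R) * ((a N.+1 - N.+1%:R * a 1%N) / N.+1%:R) =
  a N.+1 / N.+1%:R * n.+1%:R - n.+1%:R * a 1%N - (a N.+1 - N.+1%:R * a 1%N).
  by field; rewrite gt_eqF.
set x := _ / _ * _; set y := n.+1%:R * _; set z := N.+1%:R * _; lra.
Qed.

(** The limit is the supremum of the quotients. Convergence is what gives [limn] in [Qcap] its
    meaning. *)
Lemma superadditive_cvg (a : nat -> R) (L : R) :
  (forall m n, a m + a n <= a (m + n)%N) -> (forall n, a n.+1 <= n.+1%:R * L) ->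
  cvgn (fun n => a n.+1 / n.+1%:R).
Proof.
move=> sa hL; pose u n := a n.+1 / n.+1%:R.
have n0 n : 0 < n.+1%:R :> R by rewrite ltr0n.
have hs : has_sup (range u).
  split; first by exists (u 0%N), 0%N.
  by exists L => _ [n _ <-]; rewrite /u ler_pdivrMr // mulrC.
suff : u @ \oo --> sup (range u) by move=> /cvgP.
apply/cvgrPdist_le => e e0; have e2 : 0 < e / 2 by rewrite divr_gt0.
have [_ [N _ <-] hN] := sup_adherent e2 hs.
pose b := a N.+1 - N.+1%:R * a 1%N.
exists (Num.bound (`|b| / (e / 2))) => // n /= hn.
have hu : u n <= sup (range u) by apply: sup_upper_bound => //; exists n.
rewrite ger0_norm ?subr_ge0 // lerBlDr -lerBlDl.
apply: le_trans (superadditive_ge N n sa); rewrite -/(u N) -/b.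
have : b / n.+1%:R <= e / 2.
  rewrite ler_pdivrMr // mulrC -ler_pdivrMr //.
  apply: (@le_trans _ _ (`|b| / (e / 2))); first by rewrite ler_pM2r ?invr_gt0 // ler_norm.
  apply: ltW; apply: (@lt_le_trans _ _ (Num.bound (`|b| / (e / 2)))%:R).
    by apply: archi_boundP; rewrite divr_ge0 // ltW.
  by rewrite ler_nat ltnW.
by move: hN; rewrite -/(u N); set x := u N; set y := b / _; set z := sup _; lra.
Qed.

Lemma superadditive_lim_ge (a : nat -> R) (L : R) :
  (forall m n, a m + a n <= a (m + n)%N) -> (forall n, a n.+1 <= n.+1%:R * L) ->
  a 1%N <= limn (fun n => a n.+1 / n.+1%:R).
Proof.
move=> sa hL; apply: limr_ge; first exact: superadditive_cvg hL.
(* For [N = 0] the error term vanishes. *)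
apply: nearW => n; have := superadditive_ge 0 n sa.
by rewrite divr1 mul1r subrr mul0r subr0.
Qed.
End Fekete.

(** * Coherent information and regularised capacity of channels *)

Section ChannelCapacity.
Variable R : realType.
Local Notation C := R[i].
Implicit Types N M : chan R.

Definition coherent_information N (rho : op R (chA N)) : R :=
  vN_entropy (@apply_chan R N rho) - vN_entropy (@apply_comp R N rho).

Lemma density_gramP (A : finType) (rho : op R A) : density rho ->
  exists2 G : A -> A -> C, rho = gram G & trace (gram G) = 1.
Proof.
move=> [/psd_gramP [G hG] tr].
have e : rho = gram G by apply/funext => a; apply/funext => b.
by exists G => //; rewrite -e.
Qed.

Lemma density_apply N (rho : op R (chA N)) : isometric N -> density rho ->
  density (@apply_chan R N rho) /\ density (@apply_comp R N rho).
Proof.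
move=> hN /density_gramP [G -> tr].
have e1 : @apply_chan R N (gram G) = coherent_out (channel_map G).
  by apply/funext => b; apply/funext => b'; exact: apply_chan_gram.
have e2 : @apply_comp R N (gram G) = coherent_env (channel_map G).
  by apply/funext => b; apply/funext => b'; exact: apply_comp_gram.
rewrite e1 e2; split; split; try exact: psd_gram.
- rewrite -tr -trace_channel_map // rmorph_sum /trace /coherent_out /gram /=.
  under [RHS]eq_bigr do rewrite rmorph_sum /=.
  rewrite [RHS]exchange_big; apply: eq_bigr => b _ /=.
  rewrite -(pair_bigA _ (fun r e => channel_map G r b e * (channel_map G r b e)^*)).
  by apply: eq_bigr => r _; rewrite rmorph_sqn.
- rewrite -tr -trace_channel_map // pair_bigA rmorph_sum /trace /coherent_env /gram /=.
  rewrite exchange_big; apply: eq_bigr => z _ /=.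
  by rewrite rmorph_sqn.
Qed.

Lemma coherent_information_le_card N rho : isometric N -> density rho ->
  @coherent_information N rho <= log2 #|chB N|%:R.
Proof.
move=> hN hr; have [h1 h2] := density_apply hN hr.
rewrite /coherent_information lerBlDr; apply: le_trans (vN_entropy_le_card h1) _.
by rewrite lerDl vN_entropy_ge0.
Qed.

Lemma pure_density (A : finType) (a0 : A) :
  density (gram (fun a (_ : unit) => (a == a0)%:R) : op R A).
Proof.
split; first exact: psd_gram.
rewrite /trace /gram exchange_big big_const card_unit /= addr0.
under eq_bigr do rewrite conjC_nat.
by rewrite sum_deltar eqxx.
Qed.

(** A supremum bounds its set only if the set is bounded above; the output dimension supplies the
    bound. *)
Lemma Q1_ge N rho : isometric N -> density rho -> @coherent_information N rho <= Q1 N.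
Proof.
move=> hN hr; apply: sup_upper_bound; last by exists rho.
split; first by exists (@coherent_information N rho), rho.
by exists (log2 #|chB N|%:R) => _ [s [hs ->]]; exact: coherent_information_le_card.
Qed.

Lemma Q1_le N (a0 : chA N) (c : R) :
  (forall rho, density rho -> @coherent_information N rho <= c) -> Q1 N <= c.
Proof.
move=> h; apply: ge_sup; last by move=> _ [s [hs ->]]; exact: h.
pose rho : op R (chA N) := gram (fun a (_ : unit) => (a == a0)%:R).
by exists (coherent_information rho), rho; split => //; exact: pure_density.
Qed.

Lemma sum_bij_pair (X A B : finType) (f : X -> A * B) (F : A -> C) (G : B -> C) :
  bijective f -> \sum_x F (f x).1 * G (f x).2 = (\sum_a F a) * (\sum_b G b).
Proof.
move=> [g fK gK]; rewrite (reindex g) /=; last by exists f => x _; rewrite ?gK ?fK.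
under eq_bigr do rewrite gK.
rewrite -(pair_bigA _ (fun a b => F a * G b)) mulr_suml.
by apply: eq_bigr => a _; rewrite mulr_sumr.
Qed.

(** * Channels that are products up to re-indexing of their three systems *)

Section Product.
Variables (N N1 N2 : chan R).
Variables (fA : chA N -> chA N1 * chA N2) (fB : chB N -> chB N1 * chB N2)
  (fE : chE N -> chE N1 * chE N2).
Hypotheses (bA : bijective fA) (bB : bijective fB) (bE : bijective fE).
Hypothesis hV : forall b e a, chV (b, e) a =
  chV ((fB b).1, (fE e).1) (fA a).1 * chV ((fB b).2, (fE e).2) (fA a).2 :> C.

Lemma isometric_product : isometric N1 -> isometric N2 -> isometric N.
Proof.
move=> i1 i2 a a'.
transitivity ((\sum_b \sum_e chV (b, e) (fA a).1 * (chV (b, e) (fA a').1)^*) *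
              (\sum_b \sum_e chV (b, e) (fA a).2 * (chV (b, e) (fA a').2)^*) : C).
  rewrite -(sum_bij_pair _ _ bB); apply: eq_bigr => b _.
  rewrite -(sum_bij_pair _ _ bE); apply: eq_bigr => e _.
  by rewrite !hV rmorphM; ring.
rewrite i1 i2 -natrM mulnb -(bij_eq bA).
by case: (fA a) (fA a') => [x y] [z w].
Qed.

Definition product_op (rho1 : op R (chA N1)) (rho2 : op R (chA N2)) : op R (chA N) :=
  fun a a' => rho1 (fA a).1 (fA a').1 * rho2 (fA a).2 (fA a').2.

Lemma density_product rho1 rho2 : density rho1 -> density rho2 -> density (product_op rho1 rho2).
Proof.
move=> /density_gramP [G1 -> t1] /density_gramP [G2 -> t2]; split; last first.
  rewrite /trace /product_op (sum_bij_pair (fun x => gram G1 x x) (fun x => gram G2 x x) bA).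
  by rewrite -/(trace (gram G1)) -/(trace (gram G2)) t1 t2 mulr1.
have -> : product_op (gram G1) (gram G2) =
    gram (fun a (z : chA N1 * chA N2) => G1 (fA a).1 z.1 * G2 (fA a).2 z.2).
  apply/funext => a; apply/funext => a'; rewrite /product_op /gram mulr_suml.
  rewrite -(pair_bigA _ (fun i j => G1 (fA a).1 i * G2 (fA a).2 j * (G1 (fA a').1 i *
      G2 (fA a').2 j)^*)) /=.
  apply: eq_bigr => i _; rewrite mulr_sumr; apply: eq_bigr => j _.
  by rewrite rmorphM; ring.
exact: psd_gram.
Qed.

Lemma coherent_information_product rho1 rho2 :
  isometric N1 -> isometric N2 -> density rho1 -> density rho2 ->
  coherent_information (product_op rho1 rho2) =
  coherent_information rho1 + coherent_information rho2.
Proof.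
move=> i1 i2 h1 h2.
have [dB1 dE1] := density_apply i1 h1; have [dB2 dE2] := density_apply i2 h2.
rewrite /coherent_information.
rewrite (vN_entropy_tensor (tau := @apply_chan R N (product_op rho1 rho2)) bB dB1 dB2).
  rewrite (vN_entropy_tensor (tau := @apply_comp R N (product_op rho1 rho2)) bE dE1 dE2).
    by ring.
  move=> e e'; rewrite /apply_comp /ptrB /conj_map -(sum_bij_pair _ _ bB); apply: eq_bigr => b _.
  rewrite -(sum_bij_pair _ _ bA); apply: eq_bigr => a _.
  rewrite -(sum_bij_pair _ _ bA); apply: eq_bigr => a' _.
  by rewrite !hV /product_op rmorphM; ring.
move=> b b'; rewrite /apply_chan /ptrE /conj_map -(sum_bij_pair _ _ bE); apply: eq_bigr => e _.
rewrite -(sum_bij_pair _ _ bA); apply: eq_bigr => a _.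
rewrite -(sum_bij_pair _ _ bA); apply: eq_bigr => a' _.
by rewrite !hV /product_op rmorphM; ring.
Qed.

(** Product inputs have additive coherent information; the two suprema are removed one after the
    other. *)
Lemma Q1_product (a1 : chA N1) (a2 : chA N2) : isometric N1 -> isometric N2 ->
  Q1 N1 + Q1 N2 <= Q1 N.
Proof.
move=> i1 i2; rewrite -lerBrDr; apply: Q1_le => // rho1 h1.
rewrite lerBrDl -lerBrDr; apply: Q1_le => // rho2 h2.
rewrite lerBrDl -coherent_information_product //.
by apply: Q1_ge; [exact: isometric_product|exact: density_product].
Qed.
End Product.

Lemma isometric_tens N M : isometric N -> isometric M -> isometric (chan_tens N M).
Proof.
by apply: (@isometric_product (chan_tens N M) N M id id id); try exact: (Bijective (g := id)).
Qed.

Lemma isometric_pow N n : isometric N -> isometric (chan_pow N n).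
Proof.
move=> hN a a' /=.
transitivity (\prod_(i < n) \sum_b \sum_e chV (b, e) (a i) * (chV (b, e) (a' i))^* : C).
  rewrite bigA_distr_bigA /=; apply: eq_bigr => b _.
  rewrite bigA_distr_bigA /=; apply: eq_bigr => e _.
  by rewrite rmorph_prod -big_split.
under eq_bigr do rewrite hN.
have [<-|ne] := eqVneq a a'; first by rewrite big1 // => i _; rewrite eqxx.
have /existsP [i hi] : [exists i, a i != a' i].
  by apply: contraNT ne => /existsPn h; apply/eqP/ffunP => i; apply/eqP; have := h i; rewrite negbK.
by rewrite (bigD1 i) //= (negbTE hi) mul0r.
Qed.

Definition ffun_split (T : finType) m n (f : {ffun 'I_(m + n) -> T}) :
    {ffun 'I_m -> T} * {ffun 'I_n -> T} :=
  ([ffun i => f (lshift n i)], [ffun i => f (rshift m i)]).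

Lemma ffun_split_bij (T : finType) m n : bijective (@ffun_split T m n).
Proof.
exists (fun z : {ffun 'I_m -> T} * {ffun 'I_n -> T} =>
    [ffun i : 'I_(m + n) => match fintype.split i with inl j => z.1 j | inr j => z.2 j end]).
  move=> f; apply/ffunP => i; rewrite ffunE.
  by case: splitP => j e; rewrite ffunE; congr (f _); apply: val_inj.
move=> [f g]; congr (_, _); apply/ffunP => i; rewrite !ffunE.
  by rewrite (unsplitK (inl i)).
by rewrite (unsplitK (inr i)).
Qed.

Lemma Q1_pow_superadditive N (a0 : chA N) m n : isometric N ->
  Q1 (chan_pow N m) + Q1 (chan_pow N n) <= Q1 (chan_pow N (m + n)).
Proof.
move=> hN; apply: (@Q1_product (chan_pow N (m + n)) (chan_pow N m) (chan_pow N n)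
  (@ffun_split (chA N) m n) (@ffun_split (chB N) m n) (@ffun_split (chE N) m n));
  try exact: ffun_split_bij; try exact: isometric_pow; try exact: [ffun _ => a0].
move=> b e a /=; rewrite big_split_ord /=.
by congr (_ * _); apply: eq_bigr => i _; rewrite !ffunE.
Qed.

(** The first power equals [N] only up to re-indexing. Viewing it as the product of [N] with the
    trivial channel [U] reduces the comparison to [Q1_product]. *)
Lemma Q1_le_pow1 N (a0 : chA N) : isometric N -> Q1 N <= Q1 (chan_pow N 1).
Proof.
move=> hN; pose U : chan R := @Chan R unit unit unit (fun _ _ => 1).
have iU : isometric U.
  by move=> [] []; rewrite /= !big_const !card_unit /= !addr0 conjC1 mulr1.
have U0 : 0 <= Q1 U.
  have dr := pure_density tt; apply: le_trans (Q1_ge iU dr).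
  have [_ h] := density_apply iU dr; have := vN_entropy_le_card h.
  rewrite card_unit /log2 ln1 mul0r => h1.
  have [h2 _] := density_apply iU dr; have := vN_entropy_ge0 h2.
  by rewrite /coherent_information; move: h1; lra.
apply: (@le_trans _ _ (Q1 N + Q1 U)); first by rewrite lerDl.
have bij (T : finType) : bijective (fun f : {ffun 'I_1 -> T} => (f ord0, tt)).
  exists (fun z : T * unit => [ffun _ => z.1]) => [f|[x []]]; last by rewrite ffunE.
  by apply/ffunP => i; rewrite ffunE (ord1 i).
apply: (@Q1_product (chan_pow N 1) N U (fun f => (f ord0, tt)) (fun f => (f ord0, tt)) (fun f =>
    (f ord0, tt)));
  try exact: bij; try exact: tt; try exact: a0; try exact: hN; try exact: iU.
by move=> b e a /=; rewrite big_ord1 mulr1.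
Qed.

Lemma Q1_pow_le_card N (a0 : chA N) n : isometric N ->
  Q1 (chan_pow N n) <= n%:R * log2 #|chB N|%:R.
Proof.
move=> hN; apply: (@Q1_le (chan_pow N n) [ffun _ => a0]) => rho hr.
have h := coherent_information_le_card (isometric_pow hN) hr.
apply: (le_trans h).
rewrite /= card_ffun card_ord natrX /log2 lnXn.
  by rewrite -[ln _ *+ _]mulr_natl mulrA.
rewrite ltr0n lt0n; apply/eqP => B0.
have := hN a0 a0; rewrite eqxx big1 => [/esym/eqP|b]; first by rewrite oner_eq0.
by move: (fintype0 b B0).
Qed.

Lemma Qcap_cvg N (a0 : chA N) : isometric N ->
  cvgn (fun n : nat => Q1 (chan_pow N n.+1) / n.+1%:R).
Proof.
move=> hN; apply: (@superadditive_cvg R (fun n => Q1 (chan_pow N n)) (log2 #|chB N|%:R)).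
  by move=> m n; exact: Q1_pow_superadditive.
by move=> n; exact: Q1_pow_le_card.
Qed.

Lemma Q1_le_Qcap N (a0 : chA N) : isometric N -> Q1 N <= Qcap N.
Proof.
move=> hN; apply: le_trans (Q1_le_pow1 a0 hN) _.
apply: (@superadditive_lim_ge R (fun n => Q1 (chan_pow N n)) (log2 #|chB N|%:R)).
  by move=> m n; exact: Q1_pow_superadditive.
by move=> n; exact: Q1_pow_le_card.
Qed.

Lemma Qcap_le N (a0 : chA N) c : isometric N ->
  (forall n, Q1 (chan_pow N n) <= n%:R * c) -> Qcap N <= c.
Proof.
move=> hN hc; apply: limr_le; first exact: Qcap_cvg.
by apply: nearW => n; rewrite ler_pdivrMr ?ltr0n // mulrC.
Qed.
End ChannelCapacity.

(** * The platypus channel *)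

Section PlatypusBound.
Variable R : realType.
Local Notation C := R[i].

(** Products of the [eps] stay in [-1, 1], and products of the weights stay below [c ^ n] because
    weights are nonnegative; the logarithm then gives [n * log2 c]. *)
Lemma Qcap_transpose_bound (N : chan R) (K : finType) (eps : K -> R)
    (h : K -> chA N -> chB N -> C) (D : chA N -> R) (c : R) (a0 : chA N) :
  transpose_decomp eps h -> (forall k, `|eps k| <= 1) -> transpose_weight h D ->
  (forall a, D a <= c) -> 0 < c -> isometric N -> Qcap N <= log2 c.
Proof.
move=> hd he hw hD c0 hN; apply: Qcap_le => // n.
apply: (@Q1_le _ (chan_pow N n) [ffun _ => a0]) => rho hr.
have -> : n%:R * log2 c = log2 (c ^+ n).
  by rewrite /log2 lnXn // -[ln c *+ n]mulr_natl mulrA.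
pose h' (k : {ffun 'I_n -> K}) (a : {ffun 'I_n -> chA N}) (b : {ffun 'I_n -> chB N}) : C :=
  \prod_i h (k i) (a i) (b i).
apply: (@transpose_bound _ (chan_pow N n) _ (fun k : {ffun 'I_n -> K} => \prod_i eps (k i)) h'
  (fun a : {ffun 'I_n -> chA N} => \prod_i D (a i))) => //.
- move=> /= a a' b b'.
  transitivity (\prod_(i < n) \sum_e chV (c := N) (b i, e) (a i) * (chV (c :=
      N) (b' i, e) (a' i))^* : C).
    by rewrite bigA_distr_bigA /=; apply: eq_bigr => e _; rewrite rmorph_prod -big_split.
  rewrite (eq_bigr _ (fun i _ => hd _ _ _ _)).
  rewrite bigA_distr_bigA /=; apply: eq_bigr => k _.
  by rewrite /h' !rmorph_prod /= -!big_split.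
- move=> k; rewrite normr_prod; apply: prodr_ile1 => i _.
  by rewrite normr_ge0 he.
- move=> a a' /=.
  transitivity (\prod_(i < n) \sum_k \sum_b h k (a i) b * (h k (a' i) b)^* : C).
    rewrite bigA_distr_bigA /=; apply: eq_bigr => k _.
    rewrite bigA_distr_bigA /=; apply: eq_bigr => b _.
    by rewrite /h' rmorph_prod /= -big_split.
  rewrite (eq_bigr _ (fun i _ => hw _ _)).
  rewrite big_split /= rmorph_prod; congr (_ * _).
  have [<-|ne] := eqVneq a a'; first by rewrite big1 // => i _; rewrite eqxx.
  have /existsP [i hi] : [exists i, a i != a' i].
    by apply: contraNT ne => /existsPn hh; apply/eqP/ffunP => i; apply/eqP; have := hh i;
        rewrite negbK.
  by rewrite (bigD1 i) //= (negbTE hi) mul0r.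
- move=> a; rewrite -[n in c ^+ n]card_ord -prodr_const; apply: ler_prod => i _.
  by rewrite hD (transpose_weight_ge0 _ hw).
- by rewrite exprn_gt0.
- exact: isometric_pow.
Qed.

Section Platypus.
Variables (d : nat) (mu : 'I_d -> R).
Hypothesis mu0 : forall i, 0 <= mu i.
Hypothesis mu1 : \sum_i mu i = 1.

(** The isometry has real entries; splitting inputs into [ord0] and [lift ord0 j] replaces
    comparisons of naturals by equalities of ordinals, suited to delta sums. *)
Definition platypus_amp (b : 'I_d.+1) (e : 'I_d) (a : 'I_d.+1) : R :=
  if unlift ord0 a is Some j then (b == ord_max)%:R * (e == j)%:R
  else Num.sqrt (mu e) * (b == widen_ord (leqnSn d) e)%:R.

Lemma platypus_ampE b e a : chV (c := platypus mu) (b, e) a = (platypus_amp b e a)%:C.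
Proof.
rewrite /= /platypus_amp.
case: unliftP => [j ->|->] /=.
  rewrite -(inj_eq val_inj b) /= -(inj_eq val_inj e) /= /bump /= add1n eqSS.
  by case: eqP => _; case: eqP => _; rewrite /= ?mulr0 ?mul0r ?mulr1 ?rmorph0 ?rmorph1.
rewrite -(inj_eq val_inj b) /=.
by case: eqP => _; rewrite ?mulr0 ?mulr1 ?rmorph0.
Qed.

Lemma platypus_amp0 b e : platypus_amp b e ord0 = Num.sqrt (mu e) *
    (b == widen_ord (leqnSn d) e)%:R.
Proof. by rewrite /platypus_amp unlift_none. Qed.

Lemma platypus_ampS b e j : platypus_amp b e (lift ord0 j) = (b == ord_max)%:R * (e == j)%:R.
Proof. by rewrite /platypus_amp liftK. Qed.

Lemma widen_neq_max (e : 'I_d) : (widen_ord (leqnSn d) e == ord_max) = false.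
Proof. by rewrite -val_eqE /= ltn_eqF. Qed.

Lemma sqrt_mu_sq e : Num.sqrt (mu e) * Num.sqrt (mu e) = mu e.
Proof. by rewrite -expr2 sqr_sqrtr. Qed.

Lemma platypus_isometric : isometric (platypus mu).
Proof.
move=> a a'.
transitivity (\sum_b \sum_e platypus_amp b e a * platypus_amp b e a')%:C.
  rewrite rmorph_sum; apply: eq_bigr => b _; rewrite rmorph_sum; apply: eq_bigr => e _.
  by rewrite !platypus_ampE conjRC rmorphM.
rewrite -[RHS](rmorph_nat (real_complex R)); congr (_ %:C).
rewrite exchange_big /=.
case: (unliftP ord0 a) => [j ->|->]; case: (unliftP ord0 a') => [j' ->|->].
- under eq_bigr => e _.
    rewrite (eq_bigr (fun b => (b == ord_max)%:R * ((b == ord_max)%:R * ((e == j)%:R *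
        (e == j')%:R)))); last first.
      by move=> b _; rewrite !platypus_ampS; ring.
    rewrite sum_deltal eqxx mul1r; over.
  by rewrite sum_deltal (inj_eq lift_inj).
- rewrite big1 ?(negbTE (neq_lift _ _)) 1?eq_sym ?(negbTE (neq_lift _ _)) // => e _.
  rewrite big1 // => b _; rewrite platypus_ampS platypus_amp0.
  by case: (eqVneq b ord_max) => [->|_]; rewrite ?[ord_max == _]eq_sym ?widen_neq_max /=; ring.
- rewrite big1 ?(negbTE (neq_lift _ _)) // => e _.
  rewrite big1 // => b _; rewrite platypus_ampS platypus_amp0.
  by case: (eqVneq b ord_max) => [->|_]; rewrite ?[ord_max == _]eq_sym ?widen_neq_max /=; ring.
- rewrite eqxx -[RHS]mu1; apply: eq_bigr => e _.
  rewrite (eq_bigr (fun b => (b == widen_ord (leqnSn d) e)%:R * (mu e *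
      (b == widen_ord (leqnSn d) e)%:R))).
    by rewrite sum_deltal eqxx mulr1.
  by move=> b _; rewrite platypus_amp0 mulrACA sqrt_mu_sq; ring.
Qed.

(* The transposed off-diagonal part of the Choi matrix is |v><z| + |z><v| with
   v = sum_j sqrt (mu j) |j+1>|j> and z = |0>|d>; when 2 al be = 1 it is the difference of the
   projections on al v + be z and al v - be z, indexed by inr. *)
Definition platypus_h (al be : R) (k : 'I_d + 'I_d + bool) (a b : 'I_d.+1) : R :=
  match k, unlift ord0 a with
  | inl (inl e), None => Num.sqrt (mu e) * (b == widen_ord (leqnSn d) e)%:R
  | inl (inr e), Some j => (e == j)%:R * (b == ord_max)%:R
  | inr _, Some j => al * (Num.sqrt (mu j) * (b == widen_ord (leqnSn d) j)%:R)
  | inr s, None => (-1) ^+ s * be * (b == ord_max)%:R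
  | _, _ => 0
  end.

Definition platypus_eps (k : 'I_d + 'I_d + bool) : R := if k is inr s then (-1) ^+ s else 1.

Lemma sum_platypus_index (V : nmodType) (F : 'I_d + 'I_d + bool -> V) :
  \sum_k F k = \sum_e F (inl (inl e)) + \sum_e F (inl (inr e)) + (F (inr false) + F (inr true)).
Proof. by rewrite !big_sumType /= big_bool addrC [X in _ = _ + X]addrC addrC. Qed.

(** The Choi blocks with both inputs zero or both nonzero are diagonal and come from the [inl]
    vectors, the two [inr] terms cancelling there by sign. In the mixed blocks only the [inr] terms
    survive, with coefficient [2 al be = 1]. *)
Lemma platypus_transpose_decomp al be : al * be *+ 2 = 1 ->
  transpose_decomp (N := platypus mu) platypus_eps (fun k a b => (platypus_h al be k a b)%:C).
Proof.
move=> hab a a' b b'.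
transitivity (\sum_e platypus_amp b e a * platypus_amp b' e a')%:C.
  rewrite rmorph_sum; apply: eq_bigr => e _.
  by rewrite !platypus_ampE conjRC rmorphM.
transitivity (\sum_k platypus_eps k * (platypus_h al be k a' b * platypus_h al be k a b'))%:C;
    last first.
  rewrite rmorph_sum; apply: eq_bigr => k _.
  by rewrite conjRC !rmorphM.
congr (_ %:C); rewrite sum_platypus_index /=.
have S (c : R) : c = (al * be *+ 2) * c by rewrite hab mul1r.
case: (unliftP ord0 a) => [j ->|->]; case: (unliftP ord0 a') => [j' ->|->];
  rewrite ?liftK ?unlift_none.
- rewrite [X in _ = X + _ + _]big1 ?add0r; last by move=> e _; ring.
  rewrite [X in _ = _ + X](_ : _ = 0) ?addr0; last by rewrite expr0 expr1; ring.
  by apply: eq_bigr => e _; rewrite !platypus_ampS; ring.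
- rewrite [X in _ = X + _ + _]big1 ?add0r; last by move=> e _; ring.
  rewrite [X in _ = X + _]big1 ?add0r; last by move=> e _; ring.
  rewrite (eq_bigr (fun e => (e == j)%:R * (Num.sqrt (mu e) * (b == ord_max)%:R *
      (b' == widen_ord (leqnSn d) e)%:R))).
    by rewrite sum_deltal [LHS]S expr0 expr1; ring.
  by move=> e _; rewrite platypus_ampS platypus_amp0; ring.
- rewrite [X in _ = X + _ + _]big1 ?add0r; last by move=> e _; ring.
  rewrite [X in _ = X + _]big1 ?add0r; last by move=> e _; ring.
  rewrite (eq_bigr (fun e => (e == j')%:R * (Num.sqrt (mu e) * (b' == ord_max)%:R *
      (b == widen_ord (leqnSn d) e)%:R))).
    by rewrite sum_deltal [LHS]S expr0 expr1; ring.
  by move=> e _; rewrite platypus_ampS platypus_amp0; ring.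
- rewrite [X in _ = _ + X + _]big1 ?addr0; last by move=> e _; ring.
  rewrite [X in _ = _ + X](_ : _ = 0) ?addr0; last by rewrite expr0 expr1; ring.
  by apply: eq_bigr => e _; rewrite !platypus_amp0; ring.
Qed.

Definition platypus_weight (al be : R) (a : 'I_d.+1) : R :=
  if unlift ord0 a is Some j then 1 + al ^+ 2 *+ 2 * mu j else 1 + be ^+ 2 *+ 2.

(** Without the signs [eps] the two [inr] contributions add on the diagonal blocks, while the sign
    inside [platypus_h] cancels them between input 0 and the others. *)
Lemma platypus_transpose_weight al be :
  transpose_weight (N := platypus mu) (fun k a b => (platypus_h al be k a b)%:C) (platypus_weight
      al be).
Proof.
move=> a a'.
transitivity (\sum_k \sum_b platypus_h al be k a b * platypus_h al be k a' b)%:C.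
  rewrite rmorph_sum; apply: eq_bigr => k _; rewrite rmorph_sum; apply: eq_bigr => b _.
  by rewrite conjRC rmorphM.
transitivity (platypus_weight al be a * (a == a')%:R)%:C; last by rewrite rmorphM rmorph_nat.
congr (_ %:C); rewrite sum_platypus_index /= /platypus_weight.
have dd (A : finType) (x : A) (c : R) : \sum_b c * (b == x)%:R * (c * (b == x)%:R) = c ^+ 2.
  rewrite (eq_bigr (fun b => (b == x)%:R * (c ^+ 2 * (b == x)%:R))); last by move=> b _; ring.
  by rewrite sum_deltal eqxx mulr1.
have d0 (A : finType) (x y : A) (c c' : R) : x != y -> \sum_b c * (b == x)%:R * (c' *
    (b == y)%:R) = 0.
  move=> /negbTE xy; rewrite (eq_bigr (fun b => (b == x)%:R * (c * c' * (b == y)%:R)));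
      last by move=> b _; ring.
  by rewrite sum_deltal xy mulr0.
case: (unliftP ord0 a) => [j ->|->]; case: (unliftP ord0 a') => [j' ->|->];
  rewrite ?liftK ?unlift_none.
- rewrite (inj_eq lift_inj) [X in X + _ + _ = _]big1 ?add0r; last by move=> e _;
    rewrite big1 // => b _; ring.
  have -> : \sum_e \sum_b (e == j)%:R * (b == ord_max :> 'I_d.+1)%:R * ((e == j')%:R *
      (b == ord_max)%:R) = (j == j')%:R :> R.
    rewrite (eq_bigr (fun e => (e == j)%:R * (e == j')%:R)); first by rewrite sum_deltal.
    move=> e _; rewrite (eq_bigr (fun b => (b == ord_max)%:R * ((e == j)%:R * (e == j')%:R *
        (b == ord_max)%:R))).
      by rewrite sum_deltal eqxx mulr1.
    by move=> b _; ring.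
  have [<-|jj] := eqVneq j j'.
    rewrite (eq_bigr (fun b : 'I_d.+1 => al * Num.sqrt (mu j) * (b == widen_ord (leqnSn d) j)%:R *
        (al * Num.sqrt (mu j) * (b == widen_ord (leqnSn d) j)%:R))).
      by rewrite dd exprMn sqr_sqrtr // mulr1n; ring.
    by move=> b _; ring.
  rewrite (eq_bigr (fun b : 'I_d.+1 => al * Num.sqrt (mu j) * (b == widen_ord (leqnSn d) j)%:R *
      (al * Num.sqrt (mu j') * (b == widen_ord (leqnSn d) j')%:R))).
    by rewrite d0 ?mulr0 ?addr0 // -val_eqE /= val_eqE.
  by move=> b _; ring.
- rewrite (eq_sym _ ord0) (negbTE (neq_lift _ _)) mulr0.
  rewrite [X in X + _ + _ = _]big1 ?add0r; last by move=> e _; rewrite big1 // => b _; ring.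
  rewrite [X in X + _ = _]big1 ?add0r; last by move=> e _; rewrite big1 // => b _; ring.
  by rewrite -big_split big1 // => b _ /=; rewrite expr0 expr1; ring.
- rewrite (negbTE (neq_lift _ _)) mulr0.
  rewrite [X in X + _ + _ = _]big1 ?add0r; last by move=> e _; rewrite big1 // => b _; ring.
  rewrite [X in X + _ = _]big1 ?add0r; last by move=> e _; rewrite big1 // => b _; ring.
  by rewrite -big_split big1 // => b _ /=; rewrite expr0 expr1; ring.
- rewrite eqxx mulr1 [X in _ + X + _ = _]big1 ?addr0; last by move=> e _; rewrite big1 // => b _;
    ring.
  rewrite !dd !exprMn !sqrr_sign !mul1r -mulr2n; congr (_ + _).
  by rewrite -[RHS]mu1; apply: eq_bigr => e _; rewrite dd sqr_sqrtr.
Qed.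

Lemma Qcap_platypus_le (m : R) : 0 < m -> (forall i, mu i <= m) ->
  Qcap (platypus mu) <= log2 (1 + Num.sqrt m).
Proof.
move=> m0 hm; pose s := Num.sqrt m.
have s0 : 0 < s by rewrite sqrtr_gt0.
have ss : s ^+ 2 = m by rewrite sqr_sqrtr // ltW.
(* With [be ^ 2 = s / 2] and [2 al be = 1] the weights are [1 + s] and [1 + mu j / s], both at most
   [1 + s] since [s ^ 2 = m]. *)
pose be := Num.sqrt (s / 2); have be0 : 0 < be by rewrite sqrtr_gt0 divr_gt0.
have be2 : be ^+ 2 = s / 2 by rewrite sqr_sqrtr // divr_ge0 // ltW.
pose al := (be *+ 2)^-1.
have al2 : al ^+ 2 *+ 2 = s^-1.
  rewrite /al exprVn -mulr_natl -[be *+ 2]mulr_natl exprMn be2.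
  by field; rewrite gt_eqF.
apply: (@Qcap_transpose_bound (platypus mu) _ platypus_eps
  (fun k a b => (platypus_h al be k a b)%:C) (platypus_weight al be)) => //.
- exact: ord0.
- apply: platypus_transpose_decomp; rewrite /al -mulrnAr mulVf //.
  by rewrite mulrn_eq0 /= gt_eqF.
- by case=> [k|s'] /=; rewrite ?normrX ?normrN1 ?expr1n ?normr1.
- exact: platypus_transpose_weight.
- move=> a; rewrite /platypus_weight; case: unlift => [j|].
    by rewrite lerD2l al2 mulrC ler_pdivrMr // -expr2 -/s ss hm.
  rewrite lerD2l be2 -mulr_natr -/s.
  by rewrite mulfVK // pnatr_eq0.
- exact: platypus_isometric.
Qed.
End Platypus.
End PlatypusBound.

(** * The joint channel *)

Lemma sum_pairE (V : nmodType) (A B : finType) (F : A * B -> V) :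
  \sum_p F p = \sum_i \sum_j F (i, j).
Proof. by rewrite pair_bigA; apply: eq_bigr => -[]. Qed.

Lemma sum_unitE (V : nmodType) (F : unit -> V) : \sum_u F u = F tt.
Proof. by rewrite (bigD1 tt) //= big1 ?addr0 // => -[]. Qed.

Section Joint.
Variable R : realType.
Local Notation C := R[i].
Variable d : nat.
Local Notation w := (widen_ord (leqnSn d)).
Local Notation kappa := (Num.sqrt 2^-1 : R).
Local Notation erasure_half := (erasure (2^-1 : R) d).

Lemma kappa_sq : kappa * kappa = 2^-1.
Proof. by rewrite -expr2 sqr_sqrtr // invr_ge0. Qed.

Definition erasure_amp (b e : 'I_d.+1) (a : 'I_d) : R :=
  kappa * ((b == w a)%:R * (e == ord_max)%:R + (b == ord_max)%:R * (e == w a)%:R).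

Lemma erasure_ampE b e a : chV (c := erasure_half) (b, e) a = (erasure_amp b e a)%:C.
Proof.
have k1 : 1 - 2^-1 = 2^-1 :> R by field.
rewrite /= k1 /erasure_amp -!(inj_eq val_inj) /=.
have [->|ba] := eqVneq (b : nat) a.
  rewrite [X in _ + X](_ : _ = 0); last by rewrite ltn_eqF // mul0r.
  rewrite addr0 mul1r; case: eqVneq => _ /=; first by rewrite mulr1.
  by rewrite ltn_eqF // mulr0 rmorph0.
rewrite mul0r add0r /=.
by case: eqVneq => _; case: eqVneq => _; rewrite /= ?mulr1 ?mul0r ?mulr0 ?rmorph0.
Qed.

Lemma erasure_amp_sym b e a : erasure_amp b e a = erasure_amp e b a.
Proof. by rewrite /erasure_amp; ring. Qed.

Lemma w_eq (a a' : 'I_d) : (w a == w a') = (a == a').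
Proof. by []. Qed.

Lemma max_neq_widen (a : 'I_d) : (ord_max == w a) = false.
Proof. by rewrite eq_sym widen_neq_max. Qed.

(** The erasure channel applied to [|j><j'|]; by the symmetry of the amplitudes it also describes
    the environment. *)
Lemma sum_erasure_amp c c' j j' :
  \sum_f erasure_amp c f j * erasure_amp c' f j' =
  2^-1 * ((c == w j)%:R * (c' == w j')%:R + (c == ord_max)%:R * (c' == ord_max)%:R * (j == j')%:R).
Proof.
transitivity (\sum_f ((f == ord_max)%:R * ((2^-1 : R) * (c == w j)%:R * ((c' == w j')%:R *
    (f == ord_max)%:R + (c' == ord_max)%:R * (f == w j')%:R))
  + (f == w j)%:R * (2^-1 * (c == ord_max)%:R * ((c' == w j')%:R * (f == ord_max)%:R +
      (c' == ord_max)%:R * (f == w j')%:R)))).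
  by apply: eq_bigr => f _; rewrite /erasure_amp mulrACA kappa_sq; ring.
rewrite big_split /= !sum_deltal eqxx widen_neq_max max_neq_widen w_eq /=.
by rewrite mulr1n mulr0n; ring.
Qed.

Lemma erasure_isometric : isometric erasure_half.
Proof.
move=> a a'.
transitivity (\sum_b \sum_e erasure_amp b e a * erasure_amp b e a')%:C.
  rewrite rmorph_sum; apply: eq_bigr => b _; rewrite rmorph_sum; apply: eq_bigr => e _.
  by rewrite !erasure_ampE conjRC -rmorphM.
rewrite -[RHS](rmorph_nat (real_complex R)); congr (_ %:C).
under eq_bigr do rewrite sum_erasure_amp.
rewrite -mulr_sumr big_split /= sum_deltal w_eq.
rewrite (eq_bigr (fun b : 'I_d.+1 => (b == ord_max)%:R * ((b == ord_max)%:R * (a == a')%:R)));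
    last first.
  by move=> b _; ring.
by rewrite sum_deltal eqxx mul1r; field.
Qed.

Lemma Qcap_erasure_half (j0 : 'I_d) : Qcap erasure_half <= 0.
Proof.
apply: Qcap_le; [exact: j0|exact: erasure_isometric|move=> n].
rewrite mulr0; apply: (@Q1_le _ (chan_pow erasure_half n) [ffun _ => j0]) => rho _.
rewrite /coherent_information (_ : apply_chan rho = apply_comp rho) ?subrr //.
apply/funext => b; apply/funext => b'; apply: eq_bigr => e _.
have sV (x y : {ffun 'I_n -> 'I_d.+1}) (a : {ffun 'I_n -> 'I_d}) :
    chV (c := chan_pow erasure_half n) (x, y) a = chV (c := chan_pow erasure_half n) (y, x) a.
  apply: eq_bigr => i _.
  have sE b1 e1 a1 : chV (c := erasure_half) (b1, e1) a1 = chV (c := erasure_half) (e1, b1) a1.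
    by rewrite !erasure_ampE erasure_amp_sym.
  exact: sE.
by apply: eq_bigr => a _; apply: eq_bigr => a' _; rewrite !(sV e).
Qed.

Variable mu : 'I_d -> R.
Hypothesis mu0 : forall i, 0 <= mu i.
Hypothesis mu1 : \sum_i mu i = 1.
Variable j0 : 'I_d.
Hypothesis muj0 : 0 < mu j0.
Local Notation joint := (chan_tens (platypus mu) erasure_half).

Lemma joint_isometric : isometric joint.
Proof. by apply: isometric_tens; [exact: platypus_isometric|exact: erasure_isometric]. Qed.

(* Equal mixture of |0>|j0> and of the entangled vector sum_j sqrt(mu_j) |j+1>|j>: the platypus
   environment sees the same state diag(mu) in both branches. *)
Definition joint_amp (a : 'I_d.+1 * 'I_d) (r : bool) : R :=
  kappa * if r then Num.sqrt (mu a.2) * (a.1 == lift ord0 a.2)%:R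
          else (a.1 == ord0)%:R * (a.2 == j0)%:R.

Definition joint_input : op R (chA joint) := gram (fun a r => (joint_amp a r)%:C).

Lemma joint_density : density joint_input.
Proof.
split; first exact: psd_gram.
rewrite /trace /joint_input /gram.
transitivity (\sum_(a : 'I_d.+1 * 'I_d) \sum_r joint_amp a r * joint_amp a r)%:C.
  rewrite rmorph_sum; apply: eq_bigr => a _; rewrite rmorph_sum; apply: eq_bigr => r _.
  by rewrite conjRC -rmorphM.
rewrite -[RHS](rmorph1 (real_complex R)); congr (_ %:C).
rewrite exchange_big big_bool /= !sum_pairE [X in X + _]exchange_big /=.
have -> : \sum_j \sum_i joint_amp (i, j) true * joint_amp (i, j) true = 2^-1.
  rewrite -[RHS]mulr1 -[X in _ = _ * X]mu1 mulr_sumr; apply: eq_bigr => j _.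
  rewrite (eq_bigr (fun i => (i == lift ord0 j)%:R * (2^-1 * mu j * (i == lift ord0 j)%:R))).
    by rewrite sum_deltal eqxx mulr1.
  move=> i _; rewrite /joint_amp /= mulrACA kappa_sq mulrACA (sqrt_mu_sq mu0); ring.
have -> : \sum_i \sum_j joint_amp (i, j) false * joint_amp (i, j) false = 2^-1.
  transitivity (\sum_i (i == ord0 :> 'I_d.+1)%:R * ((2^-1 : R) * (i == ord0)%:R)).
    apply: eq_bigr => i _.
    rewrite (eq_bigr (fun j => (j == j0)%:R * (2^-1 * (i == ord0)%:R * (i == ord0)%:R *
        (j == j0)%:R))).
      by rewrite sum_deltal eqxx mulr1; ring.
    by move=> j _; rewrite /joint_amp /= mulrACA kappa_sq; ring.
  by rewrite sum_deltal eqxx mulr1.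
by field.
Qed.

(** [b] and [c] are the platypus and erasure outputs, [e] and [f] the corresponding environments,
    [r] the branch. *)
Definition joint_map (r : bool) (b c : 'I_d.+1) (e : 'I_d) (f : 'I_d.+1) : R :=
  kappa * Num.sqrt (mu e) *
    if r then (b == ord_max)%:R * erasure_amp c f e else (b == w e)%:R * erasure_amp c f j0.

Lemma joint_mapE r (b : chB joint) (e : chE joint) :
  channel_map (N := joint) (fun a r => (joint_amp a r)%:C) r b e = (joint_map r b.1 b.2 e.1 e.2)%:C.
Proof.
case: b e => [b c] [e f]; rewrite /channel_map.
transitivity (\sum_(a : 'I_d.+1 * 'I_d) platypus_amp mu b e a.1 * erasure_amp c f a.2 *
    joint_amp a r)%:C.
  rewrite rmorph_sum; apply: eq_bigr => a _.
  by rewrite [RHS]rmorphM [X in _ = X * _]rmorphM /= -platypus_ampE -erasure_ampE.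
congr (_ %:C); rewrite sum_pairE /=.
case: r; rewrite /joint_map /joint_amp /=.
  rewrite exchange_big /=.
  transitivity (\sum_j (j == e)%:R * (kappa * Num.sqrt (mu j) * (b == ord_max)%:R *
      erasure_amp c f j)).
    apply: eq_bigr => j _.
    rewrite (eq_bigr (fun i => (i == lift ord0 j)%:R * (platypus_amp mu b e i *
        erasure_amp c f j * kappa * Num.sqrt (mu j)))).
      by rewrite sum_deltal platypus_ampS (eq_sym e j); ring.
    by move=> i _; ring.
  by rewrite sum_deltal; ring.
transitivity (\sum_i (i == ord0)%:R * (platypus_amp mu b e i * erasure_amp c f j0 * kappa)).
  apply: eq_bigr => i _.
  rewrite (eq_bigr (fun j => (j == j0)%:R * (platypus_amp mu b e i * erasure_amp c f j * kappa *
      (i == ord0)%:R))).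
    by rewrite sum_deltal; ring.
  by move=> j _; ring.
by rewrite sum_deltal platypus_amp0; ring.
Qed.

Lemma joint_ampM (s t x y : R) : kappa * s * x * (kappa * t * y) = 2^-1 * (s * t) * (x * y).
Proof. by rewrite -{3}kappa_sq; ring. Qed.

(** The origin of the rate 1/2: merging two weights [x / 4] into [x / 2] removes [x / 2] bits of
    entropy, and [x] is summed over [mu]. *)
Lemma eta_half (x : R) : 0 <= x -> eta (x / 2) - eta (x / 4) *+ 2 = x / 2.
Proof.
move=> x0; have [->|xn] := eqVneq x 0; first by rewrite !mul0r eta0 mul0rn subr0.
have xp : 0 < x by rewrite lt_def xn.
have l2 := ln2_gt0 R.
have -> : x / 2 = 2 * (x / 4) by field.
have x4 : 0 < x / 4 by rewrite divr_gt0.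
rewrite /eta /log2 lnM ?posrE //.
set l := ln 2; set y := ln _.
have l0 : l != 0 by rewrite gt_eqF.
by field.
Qed.

Lemma out_entropy : vN_entropy (@apply_chan R joint joint_input) =
  - (\sum_e eta (mu e / 4) *+ 3 + eta 4^-1).
Proof.
(* The output is diagonal with support [pt] and weights [s]: the branch of [|0>|j0>] unerased and
   erased, then the entangled branch unerased and erased. *)
pose pt (k : 'I_d + 'I_d + 'I_d + unit) : 'I_d.+1 * 'I_d.+1 :=
  match k with inl (inl (inl e)) => (w e, w j0) | inl (inl (inr e)) => (w e, ord_max)
             | inl (inr e) => (ord_max, w e) | inr _ => (ord_max, ord_max) end.
pose s (k : 'I_d + 'I_d + 'I_d + unit) : R :=
  match k with inl (inl (inl e)) | inl (inl (inr e)) | inl (inr e) => mu e / 4 | inr _ => 4^-1 end.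
have s0 k : 0 <= s k by case: k => [[[e|e]|e]|u] /=; rewrite ?divr_ge0 ?invr_ge0.
have pti k l : (pt k == pt l) = (k == l).
  by case: k => [[[e|e]|e]|[]]; case: l => [[[e'|e']|e']|[]] //=;
    rewrite xpair_eqE ?widen_neq_max ?max_neq_widen ?eqxx ?andbT ?andbF //.
rewrite (_ : @apply_chan R joint joint_input = gram (fun x k => (Num.sqrt (s k))%:C *
    (x == pt k)%:R)).
  rewrite (@vN_entropy_gram_diag _ _ _ _ s).
    congr (- _); rewrite !big_sumType /= sum_unitE.
    by congr (_ + _); rewrite -!big_split; apply: eq_bigr => e _ /=; ring.
  move=> k l.
  rewrite (eq_bigr (fun a => (a == pt k)%:R * ((Num.sqrt (s k))%:C * (Num.sqrt (s l))%:C *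
      (a == pt l)%:R))); last first.
    by move=> a _; rewrite rmorphM /= conjRC conjC_nat; ring.
  rewrite sum_deltal pti; case: eqVneq => [<-|_]; last by rewrite !mulr0.
  by rewrite -rmorphM -expr2 sqr_sqrtr.
apply/funext => x; apply/funext => y; rewrite apply_chan_gram /coherent_out /gram.
case: x y => [b c] [b' c'].
transitivity (\sum_r \sum_e \sum_f joint_map r b c e f * joint_map r b' c' e f)%:C.
  rewrite rmorph_sum sum_pairE; apply: eq_bigr => r _.
  rewrite rmorph_sum sum_pairE; apply: eq_bigr => e _.
  rewrite rmorph_sum; apply: eq_bigr => f _.
  by rewrite !joint_mapE conjRC -rmorphM.
transitivity (\sum_k s k * (((b, c) == pt k)%:R * ((b', c') == pt k)%:R))%:C; last first.
  rewrite rmorph_sum; apply: eq_bigr => k _.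
  rewrite rmorphM rmorphM !rmorph_nat rmorphM /= conjRC conjC_nat -{1}(sqr_sqrtr (s0 k)) rmorphXn
      /=.
  by ring.
congr (_ %:C); rewrite big_bool !big_sumType /= sum_unitE.
have nat2 (p q : bool) : (p && q)%:R = p%:R * q%:R :> R by case: p; case: q;
    rewrite ?mulr0 ?mul0r ?mulr1.
(* The point (d, d) collects weight from every [e]; spreading its term over [mu] allows comparison
   for each [e]. *)
have Sum1 (F : R) : F = \sum_e mu e * F by rewrite -mulr_suml mu1 mul1r.
rewrite [X in _ = _ + X]Sum1 -!big_split; apply: eq_bigr => e _ /=.
have Et : \sum_f joint_map true b c e f * joint_map true b' c' e f =
    mu e / 4 * ((b == ord_max)%:R * (b' == ord_max)%:R * ((c == w e)%:R * (c' == w e)%:R +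
        (c == ord_max)%:R * (c' == ord_max)%:R)).
  transitivity (mu e / 2 * (b == ord_max)%:R * (b' == ord_max)%:R * \sum_f erasure_amp c f e *
      erasure_amp c' f e).
    rewrite mulr_sumr; apply: eq_bigr => f _; rewrite /joint_map.
    by rewrite joint_ampM (sqrt_mu_sq mu0); field.
  by rewrite sum_erasure_amp eqxx mulr1n; field.
have Ef : \sum_f joint_map false b c e f * joint_map false b' c' e f =
    mu e / 4 * ((b == w e)%:R * (b' == w e)%:R * ((c == w j0)%:R * (c' == w j0)%:R +
        (c == ord_max)%:R * (c' == ord_max)%:R)).
  transitivity (mu e / 2 * (b == w e)%:R * (b' == w e)%:R * \sum_f erasure_amp c f j0 *
      erasure_amp c' f j0).
    rewrite mulr_sumr; apply: eq_bigr => f _; rewrite /joint_map.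
    by rewrite joint_ampM (sqrt_mu_sq mu0); field.
  by rewrite sum_erasure_amp eqxx mulr1n; field.
by rewrite Et Ef !xpair_eqE !nat2; field.
Qed.
(* Strictness comes from the overlap mu j0 / 4 of the last two families of vectors T. *)
Lemma env_entropy : vN_entropy (@apply_comp R joint joint_input) <
  - (\sum_e (eta (mu e / 2) + eta (mu e / 4)) + eta 4^-1).
Proof.
(* With the flag in the environment both branches leave the same diagonal state, total weight
   [mu e / 2]. Without it, the first branch leaves [e] next to [j0], weight [mu e / 4], and the
   entangled branch one coherent vector of weight 1/4. *)
pose T (x : 'I_d * 'I_d.+1) (k : 'I_d + 'I_d + unit) : R :=
  match k with
  | inl (inl e) => Num.sqrt (mu e / 2) * ((x.1 == e)%:R * (x.2 == ord_max)%:R)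
  | inl (inr e) => 2^-1 * Num.sqrt (mu e) * ((x.1 == e)%:R * (x.2 == w j0)%:R)
  | inr _ => 2^-1 * Num.sqrt (mu x.1) * (x.2 == w x.1)%:R
  end.
have TE k l : gram (fun k x => (T x k)%:C) k l = (\sum_e \sum_f T (e, f) k * T (e, f) l)%:C.
  transitivity (\sum_z T z k * T z l)%:C; last by rewrite sum_pairE.
  by rewrite /gram rmorph_sum; apply: eq_bigr => z _; rewrite conjRC -rmorphM.
rewrite (_ : @apply_comp R joint joint_input = gram (fun x k => (T x k)%:C)).
  (* In the transposed Gram matrix the squared norms of these vectors form the diagonal, and an
     overlap is an off-diagonal entry. *)
  rewrite vN_entropy_gramT.
  have [_ hlt] := vN_entropy_diag_le (psd_gram (fun k x => (T x k)%:C)).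
  have := hlt (inl (inr j0)) (inr tt) isT; rewrite TE.
  rewrite (_ : \sum_e \sum_f _ = mu j0 / 4); last first.
    transitivity (\sum_e (e == j0)%:R * (mu j0 / 4)); last by rewrite sum_deltal.
    apply: eq_bigr => e _.
    transitivity (\sum_f (f == w e)%:R * (2^-1 * Num.sqrt (mu j0) * (e == j0)%:R *
        (f == w j0)%:R * (2^-1 * Num.sqrt (mu e)))).
      by apply: eq_bigr => f _; rewrite /T /=; ring.
    rewrite sum_deltal w_eq; have [->|_] := eqVneq e j0; last by rewrite !(mulr0, mul0r).
    by rewrite !mulr1 mul1r -[in RHS](sqrt_mu_sq mu0 j0); field.
  move=> /(_ _); rewrite fmorph_eq0 gt_eqF ?divr_gt0 // => /(_ isT).
  congr (_ < - _); rewrite !big_sumType /= sum_unitE -big_split.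
  have dE k : diag (gram (fun k x => (T x k)%:C)) k = \sum_e \sum_f T (e, f) k * T (e, f) k.
    by rewrite /diag TE.
  congr (_ + _).
    apply: eq_bigr => k _; rewrite !dE /T /=; congr (eta _ + eta _).
      transitivity (\sum_e (e == k)%:R * (mu k / 2)); last by rewrite sum_deltal.
      apply: eq_bigr => e _.
      transitivity (\sum_f (f == ord_max :> 'I_d.+1)%:R * (Num.sqrt (mu k / 2) ^+ 2 *
          (e == k)%:R * (e == k)%:R * (f == ord_max)%:R)).
        by apply: eq_bigr => f _; ring.
      rewrite sum_deltal eqxx sqr_sqrtr ?divr_ge0 // mulr1.
      by case: eqVneq => _; rewrite /= ?mulr0 ?mul0r ?mulr1 ?mul1r.
    transitivity (\sum_e (e == k)%:R * (mu k / 4)); last by rewrite sum_deltal.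
    apply: eq_bigr => e _.
    transitivity (\sum_f (f == w j0 :> 'I_d.+1)%:R * (4^-1 * Num.sqrt (mu k) ^+ 2 * (e == k)%:R *
        (e == k)%:R * (f == w j0)%:R)).
      by apply: eq_bigr => f _; field.
    rewrite sum_deltal eqxx sqr_sqrtr // mulr1.
    by case: eqVneq => _; rewrite /= ?mulr0 ?mul0r ?mulr1 ?mul1r // mulrC.
  congr eta; rewrite dE /T /=.
  rewrite -[RHS]mul1r -[X in _ = X * _]mu1 mulr_suml; apply: eq_bigr => e _.
  transitivity (\sum_f (f == w e :> 'I_d.+1)%:R * (4^-1 * Num.sqrt (mu e) ^+ 2 * (f == w e)%:R)).
    by apply: eq_bigr => f _; field.
  by rewrite sum_deltal eqxx sqr_sqrtr // mulr1 mulrC.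
apply/funext => x; apply/funext => y; rewrite apply_comp_gram /coherent_env /gram.
case: x y => [e f] [e' f'].
transitivity (\sum_r \sum_b \sum_c joint_map r b c e f * joint_map r b c e' f')%:C.
  rewrite rmorph_sum sum_pairE; apply: eq_bigr => r _.
  rewrite rmorph_sum sum_pairE; apply: eq_bigr => b _.
  rewrite rmorph_sum; apply: eq_bigr => c _.
  by rewrite !joint_mapE conjRC -rmorphM.
transitivity (\sum_k T (e, f) k * T (e', f') k)%:C; last first.
  by rewrite rmorph_sum; apply: eq_bigr => k _; rewrite conjRC -rmorphM.
congr (_ %:C); rewrite big_bool !big_sumType /= sum_unitE.
have Et : \sum_b \sum_c joint_map true b c e f * joint_map true b c e' f' =
    4^-1 * (Num.sqrt (mu e) * Num.sqrt (mu e')) *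
    ((f == w e)%:R * (f' == w e')%:R + (f == ord_max)%:R * (f' == ord_max)%:R * (e == e')%:R).
  transitivity (\sum_b (b == ord_max :> 'I_d.+1)%:R * (2^-1 * (Num.sqrt (mu e) *
      Num.sqrt (mu e')) * (b == ord_max)%:R *
     \sum_c erasure_amp f c e * erasure_amp f' c e')).
    apply: eq_bigr => b _; rewrite !mulr_sumr; apply: eq_bigr => c _.
    by rewrite /joint_map joint_ampM ![erasure_amp c _ _]erasure_amp_sym; ring.
  by rewrite sum_deltal eqxx mulr1n sum_erasure_amp; field.
have Ef : \sum_b \sum_c joint_map false b c e f * joint_map false b c e' f' =
    4^-1 * (Num.sqrt (mu e) * Num.sqrt (mu e')) * (e == e')%:R *
    ((f == w j0)%:R * (f' == w j0)%:R + (f == ord_max)%:R * (f' == ord_max)%:R).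
  transitivity (\sum_b (b == w e :> 'I_d.+1)%:R * (2^-1 * (Num.sqrt (mu e) * Num.sqrt (mu e')) *
      (b == w e')%:R *
     \sum_c erasure_amp f c j0 * erasure_amp f' c j0)).
    apply: eq_bigr => b _; rewrite !mulr_sumr; apply: eq_bigr => c _.
    by rewrite /joint_map joint_ampM ![erasure_amp c _ _]erasure_amp_sym; ring.
  by rewrite sum_deltal w_eq sum_erasure_amp eqxx mulr1n; field.
have dl (s : 'I_d -> R) (p q : R) : \sum_k s k * ((e == k)%:R * p) * (s k * ((e' == k)%:R * q)) =
    s e * s e' * (e == e')%:R * p * q.
  transitivity (\sum_k (k == e)%:R * (s k * s k * (e' == k)%:R * p * q)).
    by apply: eq_bigr => k _; rewrite (eq_sym e k); ring.
  rewrite sum_deltal (eq_sym e'); have [->|_] := eqVneq e e'; first by [].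
  by rewrite !(mulr0, mul0r).
rewrite Et Ef (dl (fun k => Num.sqrt (mu k / 2))) (dl (fun k => 2^-1 * Num.sqrt (mu k))) /T /=.
have -> : Num.sqrt (mu e / 2) * Num.sqrt (mu e' / 2) = 2^-1 * (Num.sqrt (mu e) * Num.sqrt (mu e')).
  by rewrite !sqrtrM // mulrACA kappa_sq mulrC.
by field.
Qed.

Lemma joint_coherent_information : 2^-1 < coherent_information (N := joint) joint_input.
Proof.
rewrite /coherent_information out_entropy ltrBrDr addrC -ltrBrDr.
apply: (lt_le_trans env_entropy).
have half : 2^-1 = \sum_e mu e / 2 by rewrite -mulr_suml mu1 mul1r.
rewrite [X in _ - X]half.
rewrite -opprD lerN2 addrAC lerD2r -big_split; apply: ler_sum => e _ /=.
have := eta_half (mu0 e); rewrite mulrS mulr2n; lra.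
Qed.

Lemma Qcap_joint_gt : 2^-1 < Qcap joint.
Proof.
apply: (lt_le_trans joint_coherent_information).
apply: (le_trans (Q1_ge joint_isometric joint_density)).
exact: (Q1_le_Qcap (N := joint) (ord0, j0) joint_isometric).
Qed.
End Joint.

Theorem theorem3 (R : realType) (d : nat) (mu : 'I_d -> R) :
  (1 <= d)%N ->
  (forall i, 0 <= mu i) -> \sum_(i < d) mu i = 1 ->
  d%:R^-1 <= \big[Num.max/0]_(i < d) mu i <= 3 - 2 * Num.sqrt 2 ->
  exists lam : R, 0 <= lam <= 1 /\
    Qcap (chan_tens (platypus mu) (erasure lam d))
      > Qcap (platypus mu) + Qcap (erasure lam d).
Proof.
move=> d0 mu0 mu1; set m := \big[_/_]_(i < d) _ => /andP[m1 m2].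
have m0 : 0 < m by apply: lt_le_trans m1; rewrite invr_gt0 ltr0n.
have hm i : mu i <= m by exact: le_bigmax.
have [j0 hj] : exists j0, 0 < mu j0.
  apply/not_existsP => h; move: mu1; rewrite big1 => [/esym/eqP|i _]; first by rewrite oner_eq0.
  by apply/eqP; rewrite eq_le mu0 andbT leNgt; apply/negP/h.
exists 2^-1; split; first by rewrite invr_ge0 ler0n invf_le1 // ler1n.
apply: le_lt_trans (Qcap_joint_gt mu0 mu1 hj).
have hP := Qcap_platypus_le mu0 mu1 m0 hm.
have hE := Qcap_erasure_half R j0.
suff : log2 (1 + Num.sqrt m) <= 2^-1 by move: hP hE; lra.
have s2 : 1 <= Num.sqrt 2 :> R by rewrite -[leLHS]sqrtr1 ler_wsqrtr // ler1n.
have ss : Num.sqrt 2 ^+ 2 = 2 :> R by rewrite sqr_sqrtr.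
(* Here [3 - 2 * sqrt 2] enters as [(sqrt 2 - 1) ^ 2]. *)
have hs : 1 + Num.sqrt m <= Num.sqrt 2.
  rewrite -lerBrDl -[leRHS]ger0_norm ?subr_ge0 // -sqrtr_sqr ler_wsqrtr //.
  by apply: le_trans m2 _; rewrite sqrrB ss; lra.
rewrite /log2 ler_pdivrMr ?ln2_gt0 //.
have : ln (1 + Num.sqrt m) <= ln (Num.sqrt 2).
  by rewrite ler_ln // posrE ?sqrtr_gt0 // ltr_pwDl // sqrtr_ge0.
move=> /le_trans; apply.
have -> : ln (2 : R) = ln (Num.sqrt 2 ^+ 2) by rewrite ss.
by rewrite lnXn ?sqrtr_gt0 // -[ln _ *+ 2]mulr_natl mulKf ?pnatr_eq0.
Qed.
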